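(* Let $W$ be a cocompact discrete reflection group of a CAT(0) space $X$, let $C$ be a chamber, and let $S$ be a minimal subset of the set $R$ of reflections in $W$ such that $C=\bigcap_{s\in S}X_s^+$. Then for each subset $T\subset S$: (1) $W_T\overline{C}$ is a convex subset of $X$ (hence a CAT(0) space); (2) the limit set $L(W_T)$ coincides with the boundary $\partial(W_T\overline{C})$; (3) the action of $W_T$ on $X$ is convex-cocompact.
   Context: An isometry $r$ of a geodesic space $X$ is a reflection if $r^2=\mathrm{id}$, the fixed-point set $F_r$ (the wall of $r$) has empty interior, $X\setminus F_r$ has exactly two convex connected components, and $r$ interchanges them. A reflection group is an isometry group generated by reflections. Let $W$ be a reflection group of $X$ acting properly (i.e. $\{\gamma\in W: \gamma x\in B(x,N)\}$ is finite for all $x\in X$, $N>0$), and $R$ the set of all reflections of $X$ lying in $W$. A chamber is a connected component $C$ of $X\setminus\bigcup_{r\in R}F_r$. $W$ is a cocompact discrete reflection group if $\overline{C}$ is compact and $\{\gamma\in W: \gamma C=C\}=\{1\}$. For $r\in R$, $X_r^+$ denotes the component of $X\setminus F_r$ containing $C$. $S\subset R$ is minimal with $C=\bigcap_{s\in S}X_s^+$; then $(W,S)$ is a Coxeter system. For $T\subset S$, $W_T$ is the subgroup generated by $T$. For a group $\Gamma$ acting properly by isometries on a CAT(0) space $X$, the limit set is $L(\Gamma)=\overline{\Gamma x_0}\cap\partial X$, where the closure is taken in $X\cup\partial X$ ($\partial X$ the visual boundary) and $x_0\in X$ (independent of $x_0$). $\Gamma$ is convex-cocompact if there is a compact $K\subset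 X$ with $\mathcal{R}_{x_0}(L(\Gamma))\subset\Gamma K$ for some $x_0\in X$, where $\mathcal{R}_{x_0}(L(\Gamma))$ is the union of the images of all geodesic rays $\xi$ from $x_0$ with $\xi(\infty)\in L(\Gamma)$. $\partial(W_T\overline{C})$ denotes the visual boundary of the convex set $W_T\overline{C}$, regarded as a subset of $\partial X$. *)

(* Defs.v *)
From Stdlib Require Import Reals List.
Open Scope R_scope.
Import ListNotations.

Section Defs.
Context {X : Type} (d : X -> X -> R).

Definition is_metric : Prop :=
  (forall x y, 0 <= d x y) /\ (forall x y, d x y = 0 <-> x = y) /\
  (forall x y, d x y = d y x) /\ (forall x y z, d x z <= d x y + d y z).

Definition geodesic (c : R -> X) (x y : X) : Prop :=
  c 0 = x /\ c (d x y) = y /\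
  forall s t, 0 <= s <= d x y -> 0 <= t <= d x y -> d (c s) (c t) = Rabs (s - t).

Definition geodesic_space : Prop :=
  is_metric /\ forall x y, exists c, geodesic c x y.

Definition eucl (u v : R * R) : R :=
  sqrt ((fst u - fst v) ^ 2 + (snd u - snd v) ^ 2).
(** point at distance t from a on the segment [a,b] of length D *)
Definition seg_pt (a b : R * R) (D t : R) : R * R :=
  (fst a + (t / D) * (fst b - fst a), snd a + (t / D) * (snd b - snd a)).

Definition CAT0 : Prop :=
  geodesic_space /\
  forall (p q r : X) (c1 c2 c3 : R -> X) (a b e : R * R),
    geodesic c1 p q -> geodesic c2 q r -> geodesic c3 r p ->
    eucl a b = d p q -> eucl b e = d q r -> eucl e a = d r p ->
    let sides := [(c1, d p q, a, b); (c2, d q r, b, e); (c3, d r p, e, a)] in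
    forall s1 s2, In s1 sides -> In s2 sides ->
    match s1, s2 with
    | (g1, D1, a1, b1), (g2, D2, a2, b2) =>
        forall t1 t2, 0 <= t1 <= D1 -> 0 <= t2 <= D2 ->
        d (g1 t1) (g2 t2) <= eucl (seg_pt a1 b1 D1 t1) (seg_pt a2 b2 D2 t2)
    end.

Definition open_set (U : X -> Prop) : Prop :=
  forall x, U x -> exists e, 0 < e /\ forall y, d x y < e -> U y.

Definition closure (A : X -> Prop) (x : X) : Prop :=
  forall e, 0 < e -> exists y, A y /\ d x y < e.

Definition empty_interior (A : X -> Prop) : Prop :=
  forall U, open_set U -> (forall x, U x -> A x) -> forall x, ~ U x.

Definition compact (K : X -> Prop) : Prop :=
  forall (I : Type) (U : I -> X -> Prop),
    (forall i, open_set (U i)) -> (forall x, K x -> exists i, U i x) ->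
    exists l : list I, forall x, K x -> exists i, In i l /\ U i x.

Definition connected (A : X -> Prop) : Prop :=
  ~ exists U V, open_set U /\ open_set V /\
      (forall x, A x -> U x \/ V x) /\
      (exists x, A x /\ U x) /\ (exists x, A x /\ V x) /\
      (forall x, A x -> U x -> V x -> False).

Definition component (Y A : X -> Prop) : Prop :=
  (forall x, A x -> Y x) /\ (exists x, A x) /\ connected A /\
  forall B, (forall x, B x -> Y x) -> connected B -> (exists x, A x /\ B x) ->
    forall x, B x -> A x.

Definition convex (A : X -> Prop) : Prop :=
  forall x y c, A x -> A y -> geodesic c x y ->
    forall t, 0 <= t <= d x y -> A (c t).

Definition isometry (f : X -> X) : Prop :=
  (forall x y, d (f x) (f y) = d x y) /\ (forall y, exists x, f x = y).

Definition fixset (f : X -> X) (x : X) : Prop := f x = x.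

Definition is_reflection (r : X -> X) : Prop :=
  isometry r /\ (forall x, r (r x) = x) /\ empty_interior (fixset r) /\
  exists A B : X -> Prop,
    component (fun x => ~ fixset r x) A /\ component (fun x => ~ fixset r x) B /\
    (forall x, ~ (A x /\ B x)) /\
    (forall x, ~ fixset r x -> A x \/ B x) /\
    convex A /\ convex B /\
    (forall x, A x -> B (r x)) /\ (forall x, B x -> A (r x)).

Definition subgroup (H : (X -> X) -> Prop) : Prop :=
  (forall f, H f -> isometry f) /\ H (fun x => x) /\
  (forall f g, H f -> H g -> H (fun x => f (g x))) /\
  (forall f, H f -> exists g, H g /\ (forall x, g (f x) = x) /\ (forall x, f (g x) = x)).

Definition generated (G : (X -> X) -> Prop) (f : X -> X) : Prop :=
  forall H, subgroup H -> (forall g, G g -> H g) -> H f.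

Definition reflection_group (W : (X -> X) -> Prop) : Prop :=
  exists G : (X -> X) -> Prop, (forall g, G g -> is_reflection g) /\
    forall f, W f <-> generated G f.

Definition proper_action (W : (X -> X) -> Prop) : Prop :=
  forall x N, 0 < N -> exists l : list (X -> X),
    forall g, W g -> d x (g x) < N -> In g l.

Definition reflections_in (W : (X -> X) -> Prop) (r : X -> X) : Prop :=
  W r /\ is_reflection r.

Definition walls_union (W : (X -> X) -> Prop) (x : X) : Prop :=
  exists r, reflections_in W r /\ r x = x.

Definition chamber (W : (X -> X) -> Prop) (C : X -> Prop) : Prop :=
  component (fun x => ~ walls_union W x) C.

Definition cocompact_discrete (W : (X -> X) -> Prop) (C : X -> Prop) : Prop :=
  reflection_group W /\ proper_action W /\ chamber W C /\
  compact (closure C) /\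
  forall g, W g -> (forall y, C y <-> exists x, C x /\ g x = y) -> forall x, g x = x.

Definition Xplus (r : X -> X) (C : X -> Prop) (x : X) : Prop :=
  exists A, component (fun y => ~ fixset r y) A /\ (forall y, C y -> A y) /\ A x.

Definition minimal_basis (W : (X -> X) -> Prop) (C : X -> Prop)
    (S : (X -> X) -> Prop) : Prop :=
  (forall s, S s -> reflections_in W s) /\
  (forall x, C x <-> forall s, S s -> Xplus s C x) /\
  forall S' : (X -> X) -> Prop, (forall s, S' s -> S s) ->
    (forall x, C x <-> forall s, S' s -> Xplus s C x) ->
    forall s, S s -> S' s.

Definition translates (G : (X -> X) -> Prop) (C : X -> Prop) (y : X) : Prop :=
  exists g x, G g /\ closure C x /\ g x = y.

(** Geodesic rays and the visual boundary (points of the boundary are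
    represented by geodesic rays issuing from a base point x0) *)
Definition ray (xi : R -> X) : Prop :=
  forall s t, 0 <= s -> 0 <= t -> d (xi s) (xi t) = Rabs (s - t).

Definition asymptotic (xi eta : R -> X) : Prop :=
  exists K, forall t, 0 <= t -> d (xi t) (eta t) <= K.

(** xi (a ray from x0) lies in the closure of A in X ∪ ∂X for the cone
    topology: every basic neighbourhood U(xi, r, e) meets A. *)
Definition cone_closure (x0 : X) (A : X -> Prop) (xi : R -> X) : Prop :=
  forall r e, 0 < r -> 0 < e -> exists a c,
    A a /\ r < d x0 a /\ geodesic c x0 a /\ d (c r) (xi r) < e.

Definition limit_ray (G : (X -> X) -> Prop) (x0 : X) (xi : R -> X) : Prop :=
  ray xi /\ xi 0 = x0 /\ cone_closure x0 (fun y => exists g, G g /\ g x0 = y) xi.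

Definition boundary_ray (Y : X -> Prop) (x0 : X) (xi : R -> X) : Prop :=
  ray xi /\ xi 0 = x0 /\
  exists eta, ray eta /\ (forall t, 0 <= t -> Y (eta t)) /\ asymptotic xi eta.

Definition convex_cocompact (G : (X -> X) -> Prop) : Prop :=
  exists (K : X -> Prop) (x0 : X), compact K /\
    forall xi, limit_ray G x0 xi -> forall t, 0 <= t ->
      exists g k, G g /\ K k /\ g k = xi t.

End Defs.

(* Main.v *)
(* Let [H_s] be the closed half-space of [s] containing [C]. An orbit point closest to the chamber
   lies in [H_t] for every generator [t], and the closure of [C] is the intersection of the [H_s], [s] in
   [S]. Minimality of [S] gives every [s] a panel point lying on no wall but that of [s]; hence
   [s] is the only reflection separating [C] from [sC], which yields the exchange condition for
   words over [T], and with it [gC] lies in [H_s] for [g] in [W_T] and [s] in [S \ T]. Therefore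
   the translates of the closed chamber by [W_T] form the intersection of the half-spaces
   [g H_s] with [g] in [W_T] and [s] in [S \ T], which is convex. Every translate of the compact
   closed chamber stays within bounded distance of an orbit point, so convexity of the metric
   turns rays in this complete convex set into limits of the orbit and back; and segments
   between orbit points of a chamber point stay in it, which is convex cocompactness. *)
From Stdlib Require Import Reals List Arith Lra Lia ClassicalEpsilon.
From Stdlib Require Import FunctionalExtensionality PropExtensionality.
Require Import Defs.
Import ListNotations.
Open Scope R_scope.

(** * Euclidean comparison triangles *)

Lemma eucl_triangle_exists (D E F : R) :
  0 <= D -> 0 <= E -> 0 <= F -> D <= E + F -> E <= D + F -> F <= D + E ->
  exists a b e, eucl a b = D /\ eucl b e = E /\ eucl e a = F.
Proof.
  intros HD HE HF H1 H2 H3.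
  assert (sq : forall x y, 0 <= y -> x = y ^ 2 -> sqrt x = y).
  { intros x y Hy ->. apply sqrt_pow2; exact Hy. }
  destruct (Req_dec D 0) as [D0|D0].
  - exists (0, 0), (0, 0), (F, 0); unfold eucl; simpl.
    repeat split; apply sq; try lra; subst; try ring.
    replace E with F by lra; ring.
  (* Law of cosines: [u] is the abscissa of the third vertex when the side of length [D] runs from
     the origin along the axis. *)
  - set (u := (D ^ 2 + F ^ 2 - E ^ 2) / (2 * D)).
    assert (Hu : 2 * D * u = D ^ 2 + F ^ 2 - E ^ 2) by (unfold u; field; lra).
    assert (Huv : 0 <= F ^ 2 - u ^ 2).
    (* Multiplied by [2 * D], each factor of [F ^ 2 - u ^ 2] becomes a difference of squares,
       nonnegative by the triangle inequalities. *)
    { assert (A1 : 0 <= 2 * D * (F - u)).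
      { replace (2 * D * (F - u)) with ((E - (D - F)) * (E + (D - F))) by nra.
        apply Rmult_le_pos; lra. }
      assert (A2 : 0 <= 2 * D * (F + u)).
      { replace (2 * D * (F + u)) with (((D + F) - E) * ((D + F) + E)) by nra.
        apply Rmult_le_pos; lra. }
      assert (0 <= F - u) by nra. assert (0 <= F + u) by nra. nra. }
    exists (0, 0), (D, 0), (u, sqrt (F ^ 2 - u ^ 2)); unfold eucl; simpl fst; simpl snd.
    pose proof (pow2_sqrt _ Huv) as Hv.
    set (v := sqrt _) in *.
    repeat split; apply sq; lra.
Qed.

Lemma ratio_bounds a b : 0 <= a <= b -> 0 < b -> 0 <= a / b <= 1.
Proof.
  intros Ha Hb; split; [apply Rle_mult_inv_pos; lra|].
  apply Rmult_le_reg_r with b; [lra|]. unfold Rdiv; rewrite Rmult_assoc, Rinv_l; lra.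
Qed.

(** * Geodesics, convexity of the metric and connected components in a CAT(0) space *)

Section Cat0.
Context {X : Type} {d : X -> X -> R} (HX : CAT0 d).

Lemma dist_nonneg x y : 0 <= d x y.
Proof. apply HX. Qed.

Lemma dist_eq0 x y : d x y = 0 <-> x = y.
Proof. apply HX. Qed.

Lemma dist_refl x : d x x = 0.
Proof. apply dist_eq0; reflexivity. Qed.

Lemma dist_sym x y : d x y = d y x.
Proof. apply HX. Qed.

Lemma dist_tri x y z : d x z <= d x y + d y z.
Proof. apply HX. Qed.

Lemma geodesic_exists x y : exists c, geodesic d c x y.
Proof. apply HX. Qed.

Lemma geodesic_rev c x y : geodesic d c x y -> geodesic d (fun t => c (d x y - t)) y x.
Proof.
  intros (c0 & c1 & ci); repeat split.
  - rewrite Rminus_0_r; exact c1.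
  - rewrite (dist_sym y x), Rminus_diag; exact c0.
  - rewrite (dist_sym y x); intros s t Hs Ht.
    rewrite ci by lra. rewrite <- Rabs_Ropp; f_equal; lra.
Qed.

Lemma geodesic_dist c x y s t : geodesic d c x y ->
  0 <= s <= d x y -> 0 <= t <= d x y -> d (c s) (c t) = Rabs (s - t).
Proof. intros (_ & _ & ci); apply ci. Qed.

Lemma geodesic_dist_start c x y t : geodesic d c x y -> 0 <= t <= d x y -> d x (c t) = t.
Proof.
  intros G Ht. pose proof (geodesic_dist _ _ _ 0 t G) as H.
  destruct G as (c0 & _). rewrite c0 in H. rewrite H by lra.
  rewrite Rabs_left1; lra.
Qed.

Lemma geodesic_dist_end c x y t : geodesic d c x y -> 0 <= t <= d x y -> d (c t) y = d x y - t.
Proof.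
  intros G Ht. pose proof (geodesic_dist _ _ _ t (d x y) G) as H.
  destruct G as (_ & c1 & _). rewrite c1 in H. rewrite H by lra.
  rewrite Rabs_left1; lra.
Qed.

Lemma geodesic_sub c x y u v : geodesic d c x y -> 0 <= u <= v -> v <= d x y ->
  geodesic d (fun t => c (u + t)) (c u) (c v).
Proof.
  intros G Hu Hv.
  assert (L : d (c u) (c v) = v - u).
  { rewrite (geodesic_dist _ _ _ _ _ G) by lra. rewrite Rabs_left1; lra. }
  repeat split.
  - f_equal; lra.
  - f_equal; lra.
  - rewrite L; intros s t Hs Ht. rewrite (geodesic_dist _ _ _ _ _ G) by lra. f_equal; lra.
Qed.

(** The CAT(0) inequality for the two sides issuing from [p]: in the comparison triangle the points
    at proportion [l] are at distance exactly [l] times the opposite side. The third side of the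
    triangle runs towards [p], so [c'] enters reversed. *)
Lemma geodesics_from_point c c' p x y l :
  geodesic d c p x -> geodesic d c' p y -> 0 <= l <= 1 ->
  d (c (l * d p x)) (c' (l * d p y)) <= l * d x y.
Proof.
  intros G G' Hl.
  destruct (geodesic_exists x y) as [c2 G2].
  pose proof (dist_nonneg p x) as Nx. pose proof (dist_nonneg p y) as Ny.
  pose proof (dist_nonneg x y) as Nxy.
  destruct (eucl_triangle_exists (d p x) (d x y) (d y p)) as (a & b & e & E1 & E2 & E3).
  1-3: apply dist_nonneg.
  { rewrite (dist_sym y p). pose proof (dist_tri p y x). rewrite (dist_sym y x) in H. lra. }
  { pose proof (dist_tri x p y). rewrite (dist_sym x p), (dist_sym p y) in H. lra. }
  { pose proof (dist_tri p x y). rewrite (dist_sym y p). lra. }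
  pose proof (proj2 HX p x y c c2 _ a b e G G2 (geodesic_rev _ _ _ G') E1 E2 E3) as H.
  cbv zeta in H.
  specialize (H (c, d p x, a, b) (fun t => c' (d p y - t), d y p, e, a)).
  cbv beta iota in H.
  specialize (H (or_introl eq_refl) (or_intror (or_intror (or_introl eq_refl)))
    (l * d p x) (d p y - l * d p y)).
  replace (d p y - (d p y - l * d p y)) with (l * d p y) in H by ring.
  eapply Rle_trans; [apply H; rewrite ?(dist_sym y p); split; nra|]. clear H.
  (* Serves the degenerate sides: when the length in the denominator of [seg_pt] is zero, the two
     vertices coincide and the quotient multiplies a zero vector. *)
  assert (zero : forall u v, eucl u v = 0 -> u = v).
  { intros [u1 u2] [v1 v2]; unfold eucl; simpl fst; simpl snd; intros H.
    pose proof (pow2_ge_0 (u1 - v1)) as P1. pose proof (pow2_ge_0 (u2 - v2)) as P2.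
    pose proof (sqrt_eq_0 _ (Rplus_le_le_0_compat _ _ P1 P2) H) as H0.
    f_equal; apply Rminus_diag_uniq, Rsqr_0_uniq; unfold Rsqr; lra. }
  assert (S1 : seg_pt a b (d p x) (l * d p x) =
    (fst a + l * (fst b - fst a), snd a + l * (snd b - snd a))).
  { unfold seg_pt. destruct (Req_dec (d p x) 0) as [Z|Z].
    - rewrite Z in *. apply zero in E1; subst b. f_equal; ring.
    - f_equal; field; exact Z. }
  assert (S2 : seg_pt e a (d y p) (d p y - l * d p y) =
    (fst e + (1 - l) * (fst a - fst e), snd e + (1 - l) * (snd a - snd e))).
  { unfold seg_pt. rewrite (dist_sym y p) in *. destruct (Req_dec (d p y) 0) as [Z|Z].
    - rewrite Z in *. apply zero in E3; subst e. f_equal; ring.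
    - f_equal; field; exact Z. }
  rewrite S1, S2, <- E2. unfold eucl; simpl fst; simpl snd.
  rewrite <- (sqrt_pow2 l) at 5 by lra.
  rewrite <- sqrt_mult; try (apply pow2_ge_0 || (apply Rplus_le_le_0_compat; apply pow2_ge_0)).
  apply Req_le; f_equal; ring.
Qed.

Lemma geodesic_unique c c' x y t :
  geodesic d c x y -> geodesic d c' x y -> 0 <= t <= d x y -> c t = c' t.
Proof.
  intros G G' Ht. apply dist_eq0.
  destruct (Req_dec (d x y) 0) as [Z|Z].
  - destruct G as (c0 & _), G' as (c0' & _). replace t with 0 by lra.
    rewrite c0, c0'. apply dist_refl.
  - pose proof (geodesics_from_point _ _ _ _ _ (t / d x y) G G') as H.
    rewrite dist_refl, Rmult_0_r in H.
    replace (t / d x y * d x y) with t in H by (field; exact Z).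
    pose proof (dist_nonneg (c t) (c' t)).
    apply Rle_antisym; [apply H|lra].
    apply ratio_bounds; pose proof (dist_nonneg x y); lra.
Qed.

(** Geodesics from [x] to [p] and from [p] to [y] concatenate to a geodesic when the lengths add up,
    and uniqueness identifies it with [c]. *)
Lemma geodesic_through c x y p u : geodesic d c x y -> d x p = u -> d x y = u + d p y -> c u = p.
Proof.
  intros G D1 D2.
  destruct (geodesic_exists x p) as [c1 G1], (geodesic_exists p y) as [c2 G2].
  pose proof (dist_nonneg x p). pose proof (dist_nonneg p y).
  set (e := fun t => if Rle_dec t u then c1 t else c2 (t - u)).
  assert (c1u : c1 u = p) by (rewrite <- D1; apply G1).
  assert (Ge : geodesic d e x y).
  (* The path through [p] bounds this distance above; the total length [d x y] bounds it below. *)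
  { assert (step : forall s t, 0 <= s <= u -> u <= t <= d x y -> d (c1 s) (c2 (t - u)) = t - s).
    { intros s t Hs Ht.
      pose proof (geodesic_dist_start _ _ _ s G1). pose proof (geodesic_dist_end _ _ _ s G1).
      pose proof (geodesic_dist_start _ _ _ (t - u) G2).
      pose proof (geodesic_dist_end _ _ _ (t - u) G2).
      pose proof (dist_tri (c1 s) p (c2 (t - u))). pose proof (dist_tri x (c1 s) y).
      pose proof (dist_tri (c1 s) (c2 (t - u)) y). lra. }
    unfold e; split; [|split].
    - destruct Rle_dec; [apply G1|lra].
    - destruct Rle_dec.
      + assert (Z : d p y = 0) by lra. apply dist_eq0 in Z. subst y.
        replace (d x p) with u by lra. exact c1u.
      + replace (d x y - u) with (d p y) by lra. apply G2.
    - intros s t Hs Ht. do 2 destruct Rle_dec.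
      + apply (geodesic_dist _ _ _ _ _ G1); lra.
      + rewrite step by lra. rewrite Rabs_left1; lra.
      + rewrite dist_sym, step by lra. rewrite Rabs_pos_eq; lra.
      + rewrite (geodesic_dist _ _ _ _ _ G2) by lra. f_equal; lra. }
  rewrite (geodesic_unique _ _ _ _ u G Ge) by lra.
  unfold e; destruct Rle_dec; [exact c1u|lra].
Qed.

(** Convexity of the metric: compare both geodesics with the diagonal from [x] to [y'], once from
    each of its ends. *)
Lemma quadrilateral c c' x y x' y' l :
  geodesic d c x y -> geodesic d c' x' y' -> 0 <= l <= 1 ->
  d (c (l * d x y)) (c' (l * d x' y')) <= (1 - l) * d x x' + l * d y y'.
Proof.
  intros G G' Hl. destruct (geodesic_exists x y') as [e Ge].
  pose proof (geodesics_from_point _ _ _ _ _ l G Ge Hl) as H1.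
  pose proof (geodesics_from_point _ _ _ _ _ (1 - l) (geodesic_rev _ _ _ Ge)
    (geodesic_rev _ _ _ G')) as H2. cbv beta in H2.
  rewrite (dist_sym y' x), (dist_sym y' x') in H2.
  replace (d x y' - (1 - l) * d x y') with (l * d x y') in H2 by ring.
  replace (d x' y' - (1 - l) * d x' y') with (l * d x' y') in H2 by ring.
  pose proof (dist_tri (c (l * d x y)) (e (l * d x y')) (c' (l * d x' y'))). lra.
Qed.

(** Comparison at equal times instead of equal proportions. Passing from one to the other costs
    another [l * d x y], since the two lengths differ by at most [d x y]; hence the factor 2. *)
Lemma geodesics_from_point_at c c' p x y t :
  geodesic d c p x -> geodesic d c' p y -> 0 < d p x -> 0 <= t <= d p x -> t <= d p y ->
  d (c t) (c' t) <= 2 * (t / d p x) * d x y.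
Proof.
  intros G G' Hp Ht Ht'.
  set (l := t / d p x).
  assert (El : l * d p x = t) by (unfold l; field; lra).
  assert (Hl : 0 <= l <= 1) by nra.
  pose proof (geodesics_from_point _ _ _ _ _ l G G' Hl) as H. rewrite El in H.
  pose proof (dist_nonneg p y).
  pose proof (dist_tri (c t) (c' (l * d p y)) (c' t)) as H2.
  rewrite (geodesic_dist _ _ _ (l * d p y) t G') in H2 by nra.
  assert (Rabs (l * d p y - t) <= l * d x y); [|nra].
  rewrite <- El at 1. rewrite <- Rmult_minus_distr_l, Rabs_mult, (Rabs_pos_eq l) by lra.
  apply Rmult_le_compat_l; [lra|].
  pose proof (dist_tri p x y). pose proof (dist_tri p y x). rewrite (dist_sym y x) in *.
  apply Rabs_le; lra.
Qed.

Lemma ray_geodesic xi n : ray d xi -> 0 <= n -> geodesic d xi (xi 0) (xi n).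
Proof.
  intros Hr Hn. assert (L : d (xi 0) (xi n) = n).
  { rewrite Hr by lra. rewrite Rabs_left1; lra. }
  repeat split; rewrite L; [reflexivity|]. intros; apply Hr; lra.
Qed.

Lemma ray_dist0 xi n : ray d xi -> 0 <= n -> d (xi 0) (xi n) = n.
Proof. intros Hr Hn. rewrite Hr by lra. rewrite Rabs_left1; lra. Qed.

(** The supremum of the parameters in [[s, t]] whose points lie in [U] can belong neither to [U] nor
    to [V], both being open. *)
Lemma segment_no_jump c x y (U V : X -> Prop) s t : geodesic d c x y ->
  open_set d U -> open_set d V ->
  (forall u, 0 <= u <= d x y -> U (c u) \/ V (c u)) ->
  (forall u, 0 <= u <= d x y -> U (c u) -> V (c u) -> False) ->
  0 <= s <= t -> t <= d x y -> U (c s) -> V (c t) -> False.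
Proof.
  intros G oU oV cov dis Hst Ht Us Vt.
  destruct (completeness (fun u => s <= u <= t /\ U (c u))) as [m [ub lub]].
  { exists t; intros u [H _]; lra. }
  { exists s; split; [lra|exact Us]. }
  assert (sm : s <= m) by (apply ub; split; [lra|exact Us]).
  assert (mt : m <= t) by (apply lub; intros u [H _]; lra).
  destruct (cov m ltac:(lra)) as [Um|Vm].
  - destruct (Req_dec m t) as [->|ne]; [exact (dis t ltac:(lra) Um Vt)|].
    destruct (oU _ Um) as (e & e0 & He).
    set (u := Rmin t (m + e / 2)).
    assert (Hu : m < u <= t /\ u <= m + e / 2) by (unfold u, Rmin; destruct Rle_dec; lra).
    assert (u <= m); [|lra]. apply ub; split; [lra|]. apply He.
    rewrite (geodesic_dist _ _ _ _ _ G) by lra. rewrite Rabs_left1; lra.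
  - destruct (oV _ Vm) as (e & e0 & He).
    assert (m <= m - e / 2); [|lra]. apply lub. intros u [Hu Uu].
    apply Rnot_lt_le; intros Hlt. assert (u <= m) by (apply ub; auto).
    apply (dis u ltac:(lra) Uu). apply He.
    rewrite (geodesic_dist _ _ _ _ _ G) by lra. rewrite Rabs_pos_eq; lra.
Qed.

Lemma segment_connected c x y : geodesic d c x y ->
  connected d (fun z => exists t, 0 <= t <= d x y /\ c t = z).
Proof.
  intros G (U & V & oU & oV & cov & (u & (s & Hs & <-) & Us) & (v & (t & Ht & <-) & Vt) & dis).
  assert (cov' : forall u, 0 <= u <= d x y -> U (c u) \/ V (c u)) by (intros; apply cov; eauto).
  assert (dis' : forall u, 0 <= u <= d x y -> U (c u) -> V (c u) -> False)
    by (intros; eapply dis; eauto).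
  destruct (Rle_dec s t).
  - eapply (segment_no_jump c x y U V s t); eauto; lra.
  - eapply (segment_no_jump c x y V U t s); eauto; try lra.
    intros w Hw; destruct (cov' w Hw); auto.
Qed.

(** The segment is a connected part of [Y] meeting [A], so the maximality of a component absorbs
    it. *)
Lemma component_segment (Y A : X -> Prop) c x y : component d Y A -> A x -> geodesic d c x y ->
  (forall t, 0 <= t <= d x y -> Y (c t)) -> A y.
Proof.
  intros (_ & _ & _ & mx) Ax G HY.
  pose proof (dist_nonneg x y). destruct G as (c0 & c1 & ci) eqn:?.
  apply (mx (fun z => exists t, 0 <= t <= d x y /\ c t = z)).
  - intros z (t & Ht & <-); auto.
  - apply segment_connected; exact G.
  - exists x; split; [exact Ax|]. exists 0; split; [lra|exact c0].
  - exists (d x y); split; [lra|exact c1].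
Qed.

Lemma component_ball (Y A : X -> Prop) x e y : component d Y A -> A x ->
  (forall z, d x z < e -> Y z) -> d x y < e -> A y.
Proof.
  intros cA Ax HY Hy. destruct (geodesic_exists x y) as [c G].
  eapply component_segment; eauto. intros t Ht. apply HY.
  rewrite (geodesic_dist_start _ _ _ _ G Ht). lra.
Qed.

Lemma component_eq (Y A B : X -> Prop) x : component d Y A -> component d Y B -> A x -> B x ->
  forall y, A y -> B y.
Proof.
  intros (YA & _ & cA & _) (_ & _ & _ & mB) Ax Bx. apply mB; eauto.
Qed.

End Cat0.

(** * Compactness, Cauchy sequences and limits of geodesics *)

Section Convergence.
Context {X : Type} {d : X -> X -> R} (HX : CAT0 d).

Definition cauchy (u : nat -> X) : Prop :=
  forall e, 0 < e -> exists N, forall n m, (N <= n)%nat -> (N <= m)%nat -> d (u n) (u m) < e.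

Definition converges (u : nat -> X) (z : X) : Prop :=
  forall e, 0 < e -> exists N, forall n, (N <= n)%nat -> d (u n) z < e.

Lemma list_eventually {A : Type} (P : A -> nat -> Prop) (l : list A) :
  (forall a, In a l -> exists N, forall n, (N <= n)%nat -> P a n) ->
  exists N, forall n a, (N <= n)%nat -> In a l -> P a n.
Proof.
  induction l as [|b l IH]; intros H.
  - exists O; intros n a _ [].
  - destruct IH as [N HN]; [intros a Ha; apply H; right; exact Ha|].
    destruct (H b) as [N' HN']; [left; reflexivity|].
    exists (max N N'). intros n a Hn [<-|Ha]; [apply HN'|apply HN]; auto; lia.
Qed.

(** If no point of [K] were the limit, each would be the centre of a ball that the sequence
    eventually avoids. Finitely many such balls cover [K], so late terms could not lie in [K]. *)
Lemma compact_cauchy (K : X -> Prop) u : compact d K -> cauchy u ->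
  (forall N, exists n, (N <= n)%nat /\ K (u n)) -> exists z, K z /\ converges u z.
Proof.
  intros cK cu freq. apply NNPP; intros N.
  set (away := fun x e M => 0 < e /\ forall n, (M <= n)%nat -> e <= d (u n) x).
  destruct (cK (X * R * nat)%type
    (fun i y => let '(x, e, M) := i in away x e M /\ d x y < e)) as [l Hl].
  - intros [[x e] M] y [Ha Hy]. exists (e - d x y); split; [lra|].
    intros z Hz; split; [exact Ha|]. pose proof (dist_tri HX x y z); lra.
  - intros x Kx. apply NNPP; intros Nx. apply N. exists x; split; [exact Kx|].
    intros e e0. apply NNPP; intros Ne. apply Nx.
    destruct (cu (e / 2) ltac:(lra)) as [M HM].
    exists (x, e / 2, M); split; [|rewrite (dist_refl HX); lra].
    split; [lra|]. intros n Hn. apply Rnot_lt_le; intros Hlt. apply Ne. exists M.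
    intros m Hm. pose proof (HM m n Hm Hn). pose proof (dist_tri HX (u m) (u n) x). lra.
  - destruct (list_eventually (fun i n => let '(x, e, M) := i in away x e M -> e <= d (u n) x) l)
      as [M HM].
    + intros [[x e] M] _. exists M. intros n Hn [_ H]; auto.
    + destruct (freq M) as (n & Hn & Kn). destruct (Hl _ Kn) as ([[x e] M'] & Hi & Ha & Hd).
      pose proof (HM n _ Hn Hi Ha). rewrite (dist_sym HX) in Hd. lra.
Qed.

Lemma compact_bounded (K : X -> Prop) x0 : compact d K ->
  exists M, 0 <= M /\ forall x, K x -> d x0 x <= M.
Proof.
  intros cK. destruct (cK nat (fun n x => d x0 x < INR n)) as [l Hl].
  - intros n x Hx. exists (INR n - d x0 x); split; [lra|].
    intros y Hy. pose proof (dist_tri HX x0 x y); lra.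
  - intros x _. destruct (INR_unbounded (d x0 x)) as [n Hn]; exists n; lra.
  - destruct (list_eventually (fun n m => INR n <= INR m) l) as [M HM].
    + intros n _; exists n; intros; apply le_INR; assumption.
    + exists (INR M); split; [apply pos_INR|]. intros x Kx.
      destruct (Hl x Kx) as (n & Hn & Hx). pose proof (HM M n (le_n _) Hn). lra.
Qed.

Lemma converges_dist u v y z : converges u y -> converges v z -> forall a N,
  (forall n, (N <= n)%nat -> d (u n) (v n) = a) -> d y z = a.
Proof.
  intros Hu Hv a N H. apply Rle_antisym; apply Rnot_lt_le; intros Hlt;
    set (e := Rabs (d y z - a) / 2);
    assert (e0 : 0 < e) by (unfold e; unfold Rabs; destruct Rcase_abs; lra);
    destruct (Hu e e0) as [N1 H1], (Hv e e0) as [N2 H2];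
    set (n := max N (max N1 N2));
    specialize (H n ltac:(lia)); specialize (H1 n ltac:(lia)); specialize (H2 n ltac:(lia)).
  - pose proof (dist_tri HX y (u n) z). pose proof (dist_tri HX (u n) (v n) z).
    rewrite (dist_sym HX y (u n)) in *. unfold e in *; rewrite Rabs_pos_eq in * by lra. lra.
  - pose proof (dist_tri HX (u n) y (v n)). pose proof (dist_tri HX y z (v n)).
    rewrite (dist_sym HX z (v n)) in *. unfold e in *; rewrite Rabs_left1 in * by lra. lra.
Qed.

(* The ray is the limit of the geodesics from [y0] to the points of [Y] near [xi (INR n)]. *)
Lemma shadow_ray (Y : X -> Prop) xi y0 D : convex d Y ->
  (forall u, cauchy u -> (exists N, forall n, (N <= n)%nat -> Y (u n)) ->
    exists z, Y z /\ converges u z) ->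
  ray d xi -> Y y0 -> (forall n, exists p, Y p /\ d (xi (INR n)) p <= D) ->
  exists eta, ray d eta /\ (forall t, 0 <= t -> Y (eta t)) /\ asymptotic d xi eta.
Proof.
  intros vY compl Hr Yy Hp.
  apply (choice (fun n p => Y p /\ d (xi (INR n)) p <= D)) in Hp as [p Hp].
  destruct (choice (fun n c => geodesic d c y0 (p n))) as [c Gc].
  { intros n; apply (geodesic_exists HX). }
  (* [E] bounds the gap between [xi] and [c n] at both ends, hence at every common proportion. *)
  set (E := d (xi 0) y0 + D). set (L := fun n => d y0 (p n)).
  assert (D0 : 0 <= D) by (pose proof (dist_nonneg HX (xi (INR O)) (p O));
    pose proof (proj2 (Hp O)); lra).
  assert (E0 : D <= E) by (unfold E; pose proof (dist_nonneg HX (xi 0) y0); lra).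
  assert (E1 : d (xi 0) y0 <= E) by (unfold E; lra).
  assert (near : forall n l, 0 <= l <= 1 -> d (xi (l * INR n)) (c n (l * L n)) <= E).
  { intros n l Hl. pose proof (pos_INR n) as Pn.
    pose proof (quadrilateral HX _ _ _ _ _ _ l (ray_geodesic xi (INR n) Hr Pn) (Gc n) Hl) as H.
    rewrite (ray_dist0 xi _ Hr Pn) in H. fold (L n) in H.
    destruct (Hp n) as [_ Hn]. nra. }
  assert (HL : forall n, INR n - E <= L n <= INR n + E).
  { intros n. pose proof (pos_INR n) as Pn. destruct (Hp n) as [_ Hn].
    pose proof (ray_dist0 xi (INR n) Hr Pn) as H.
    pose proof (dist_tri HX (xi 0) y0 (xi (INR n))).
    pose proof (dist_tri HX y0 (p n) (xi (INR n))).
    pose proof (dist_tri HX y0 (xi 0) (p n)).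
    pose proof (dist_tri HX (xi 0) (xi (INR n)) (p n)).
    rewrite (dist_sym HX (p n) (xi (INR n))), (dist_sym HX y0 (xi 0)) in *. fold (L n) in *.
    unfold E; lra. }
  (* Cauchy estimate at a fixed time. The point [q] of [c m] at proportion [INR n / INR m] is within
     [2 * E] of [p n], so the two geodesics from [y0] are compared at time [t] as sides of a long
     thin triangle. *)
  assert (step : forall n m t, (n <= m)%nat -> 0 <= t -> t + 2 * E < INR n ->
    d (c n t) (c m t) <= 4 * E * t / (INR n - E)).
  { intros n m t Hnm Ht Hn. pose proof (le_INR _ _ Hnm) as Hm.
    set (l := INR n / INR m).
    assert (El : l * INR m = INR n) by (unfold l; field; lra).
    assert (Hl : 0 <= l <= 1) by (apply ratio_bounds; lra).
    pose proof (near m l Hl) as H1. rewrite El in H1. set (q := c m (l * L m)) in *.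
    pose proof (dist_nonneg HX y0 (p m)) as Lm. fold (L m) in Lm.
    assert (Gq : geodesic d (fun t => c m (0 + t)) y0 q).
    { replace y0 with (c m 0) by apply Gc. apply (geodesic_sub _ _ _ _ _ (Gc m)).
      - split; [lra|apply Rmult_le_pos; lra].
      - fold (L m); nra. }
    pose proof (HL n) as H2.
    assert (H3 : d (p n) q <= 2 * E).
    { destruct (Hp n) as [_ H]. pose proof (dist_tri HX (p n) (xi (INR n)) q).
      rewrite (dist_sym HX (p n) (xi (INR n))) in *. lra. }
    assert (H4 : t <= d y0 q).
    { pose proof (ray_dist0 xi (INR n) Hr (pos_INR n)).
      pose proof (dist_tri HX (xi 0) y0 (xi (INR n))).
      pose proof (dist_tri HX y0 q (xi (INR n))).
      rewrite (dist_sym HX q (xi (INR n))) in *. lra. }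
    pose proof (geodesics_from_point_at HX _ _ _ _ _ t (Gc n) Gq) as H5.
    cbv beta in H5. rewrite Rplus_0_l in H5. fold (L n) in H5.
    eapply Rle_trans; [apply H5; lra|]. clear H5.
    apply Rle_trans with (2 * (t / (INR n - E)) * (2 * E)); [|right; field; lra].
    assert (t / L n <= t / (INR n - E)).
    { apply Rmult_le_compat_l; [lra|]. apply Rinv_le_contravar; lra. }
    assert (0 <= t / L n) by (apply Rle_mult_inv_pos; lra).
    apply Rmult_le_compat; try lra; apply (dist_nonneg HX). }
  assert (lim : forall t, exists z, 0 <= t -> Y z /\ converges (fun n => c n t) z).
  { intros t. destruct (Rle_dec 0 t) as [Ht|Ht]; [|exists y0; lra].
    destruct (compl (fun n => c n t)) as [z Hz]; [| |exists z; auto].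
    - intros e e0. destruct (INR_unbounded (t + 2 * E + 4 * E * t / e)) as [N HN].
      exists N.
      assert (S0 : 0 <= 4 * E * t / e) by (apply Rle_mult_inv_pos; nra).
      assert (K : forall n m, (N <= n)%nat -> (n <= m)%nat -> d (c n t) (c m t) < e).
      { intros n m Hn Hm. pose proof (le_INR _ _ Hn).
        eapply Rle_lt_trans; [apply step; auto; lra|].
        apply Rmult_lt_reg_r with (INR n - E); [lra|].
        replace (4 * E * t / (INR n - E) * (INR n - E)) with (4 * E * t / e * e) by (field; lra).
        rewrite (Rmult_comm e). apply Rmult_lt_compat_r; lra. }
      intros n m Hn Hm. destruct (Nat.le_gt_cases n m) as [H|H]; [auto|].
      rewrite (dist_sym HX); apply K; lia.
    - destruct (INR_unbounded (t + E)) as [N HN]. exists N. intros n Hn.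
      apply le_INR in Hn. pose proof (HL n).
      apply (vY y0 (p n) (c n) Yy (proj1 (Hp n)) (Gc n)). fold (L n); lra. }
  apply choice in lim as [eta Heta]. exists eta.
  assert (large : forall t, exists N, forall n, (N <= n)%nat -> t < L n /\ t < INR n).
  { intros t. destruct (INR_unbounded (t + E)) as [N HN]. exists N. intros n Hn.
    apply le_INR in Hn. pose proof (HL n). lra. }
  split; [|split; [intros t Ht; apply Heta, Ht|]].
  - intros s t Hs Ht. destruct (large (Rmax s t)) as [N HN].
    apply (converges_dist _ _ _ _ (proj2 (Heta s Hs)) (proj2 (Heta t Ht)) _ N).
    intros n Hn. destruct (HN n Hn) as [H _]. pose proof (Rmax_l s t). pose proof (Rmax_r s t).
    apply (geodesic_dist _ _ _ _ _ (Gc n)); fold (L n); lra.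
  (* One [E] compares [xi] and [c n] at equal proportions, the second passes to equal times, and 1
     is the distance from the limit. *)
  - exists (2 * E + 1). intros t Ht. destruct (large t) as [N HN].
    destruct (proj2 (Heta t Ht) 1 ltac:(lra)) as [N' HN'].
    set (n := max N N'). destruct (HN n ltac:(lia)) as [H1 H2]. specialize (HN' n ltac:(lia)).
    set (l := t / INR n).
    assert (El : l * INR n = t) by (unfold l; field; lra).
    assert (Hl : 0 <= l <= 1) by (apply ratio_bounds; lra).
    pose proof (near n l Hl) as H3. rewrite El in H3.
    assert (H4 : d (c n (l * L n)) (c n t) <= E).
    { rewrite (geodesic_dist _ _ _ _ _ (Gc n)) by (fold (L n); nra).
      rewrite <- El at 1. rewrite <- Rmult_minus_distr_l, Rabs_mult, (Rabs_pos_eq l) by lra.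
      assert (Rabs (L n - INR n) <= E) by (apply Rabs_le; pose proof (HL n); lra).
      pose proof (Rabs_pos (L n - INR n)). nra. }
    pose proof (dist_tri HX (xi t) (c n (l * L n)) (eta t)).
    pose proof (dist_tri HX (c n (l * L n)) (c n t) (eta t)). lra.
Qed.

End Convergence.

(** * Words in involutions, and transport of components and reflections by isometries *)

Section Groups.
Context {X : Type} {d : X -> X -> R} (HX : CAT0 d).

Definition word (l : list (X -> X)) (x : X) : X := fold_right (fun f y => f y) x l.

Lemma word_app l l' x : word (l ++ l') x = word l (word l' x).
Proof. apply fold_right_app. Qed.

Lemma isometry_dist f x y : isometry d f -> d (f x) (f y) = d x y.
Proof. intros [H _]; apply H. Qed.

Lemma isometry_id : isometry d (fun x => x).
Proof. split; eauto. Qed.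

Lemma isometry_comp f g : isometry d f -> isometry d g -> isometry d (fun x => f (g x)).
Proof.
  intros [If Sf] [Ig Sg]; split.
  - intros x y; rewrite If; apply Ig.
  - intros y; destruct (Sf y) as [z <-], (Sg z) as [x <-]; eauto.
Qed.

Lemma geodesic_image g c x y : isometry d g -> geodesic d c x y ->
  geodesic d (fun t => g (c t)) (g x) (g y).
Proof.
  intros [I _] (c0 & c1 & ci). unfold geodesic. rewrite I, c0, c1.
  split; [reflexivity|split; [reflexivity|]]. intros; rewrite I; auto.
Qed.

Lemma open_preimage g U : isometry d g -> open_set d U -> open_set d (fun x => U (g x)).
Proof.
  intros [I _] oU x Ux. destruct (oU _ Ux) as (e & e0 & He).
  exists e; split; [exact e0|]. intros y Hy; apply He; rewrite I; exact Hy.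
Qed.

Section Generated.
Context (T : (X -> X) -> Prop)
  (HT : forall t, T t -> isometry d t /\ forall x, t (t x) = x).

Lemma word_isometry l : Forall T l -> isometry d (word l).
Proof.
  induction 1 as [|t l Ht _ IH]; [apply isometry_id|].
  apply (isometry_comp t (word l)); [apply HT; exact Ht|exact IH].
Qed.

Lemma word_rev l x : Forall T l -> word (rev l) (word l x) = x.
Proof.
  intros H; induction H as [|t l Ht _ IH]; [reflexivity|].
  simpl rev; rewrite word_app; simpl. rewrite (proj2 (HT t Ht)); exact IH.
Qed.

(** The generators are involutions, so reversing a word inverts it and the words already form a
    subgroup. *)
Lemma generated_word f : generated d T f <-> exists l, Forall T l /\ f = word l.
Proof.
  split.
  - intros Hf. apply Hf.
    + repeat split.
      * destruct H as (l & Hl & ->); apply word_isometry; exact Hl.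
      * destruct H as (l & Hl & ->); apply word_isometry; exact Hl.
      * exists []; split; [constructor|reflexivity].
      * intros g h (l & Hl & ->) (l' & Hl' & ->). exists (l ++ l').
        split; [apply Forall_app; auto|].
        apply functional_extensionality; intros x; symmetry; apply word_app.
      * intros g (l & Hl & ->). exists (word (rev l)).
        assert (Hr : Forall T (rev l)) by (apply Forall_rev; exact Hl).
        split; [eauto|split]; intros x; [apply word_rev; exact Hl|].
        rewrite <- (rev_involutive l) at 1; apply word_rev; exact Hr.
    + intros t Ht; exists [t]; split; [auto|reflexivity].
  - intros (l & Hl & ->) H HH HTH.
    induction Hl as [|t l Ht _ IH]; [apply (proj1 (proj2 HH))|].
    apply (proj1 (proj2 (proj2 HH)) t (word l)); auto.
Qed.

Lemma generated_subgroup : subgroup d (generated d T).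
Proof.
  repeat split.
  - apply generated_word in H as (l & Hl & ->); apply word_isometry; exact Hl.
  - apply generated_word in H as (l & Hl & ->); apply word_isometry; exact Hl.
  - intros H HH _; apply HH.
  - intros f g Hf Hg H HH HTH; apply HH; [apply Hf|apply Hg]; auto.
  - intros f Hf; apply generated_word in Hf as (l & Hl & ->). exists (word (rev l)).
    assert (Hr : Forall T (rev l)) by (apply Forall_rev; exact Hl).
    split; [apply generated_word; eauto|split]; intros x; [apply word_rev; exact Hl|].
    rewrite <- (rev_involutive l) at 1; apply word_rev; exact Hr.
Qed.

End Generated.

Lemma generated_base (T : (X -> X) -> Prop) t : T t -> generated d T t.
Proof. intros Ht H _ HT; auto. Qed.

Section Transport.
Context (g h : X -> X) (Ig : isometry d g) (Ih : isometry d h)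
  (gh : forall x, g (h x) = x) (hg : forall x, h (g x) = x).

(** The image of [A] under [g] is written as its preimage under the inverse [h]; a separation of it
    pulls back along [g]. *)
Lemma connected_image A : connected d A -> connected d (fun x => A (h x)).
Proof.
  intros cA (U & V & oU & oV & cov & (u & Au & Uu) & (v & Av & Vv) & dis).
  apply cA. exists (fun x => U (g x)), (fun x => V (g x)).
  split; [apply open_preimage; auto|]. split; [apply open_preimage; auto|].
  split; [intros x Ax; apply cov; rewrite hg; exact Ax|].
  split; [exists (h u); rewrite gh; auto|]. split; [exists (h v); rewrite gh; auto|].
  intros x Ax; apply dis; rewrite hg; exact Ax.
Qed.

Lemma convex_image A : convex d A -> convex d (fun x => A (h x)).
Proof.
  intros cA x y c Ax Ay G t Ht.
  apply (cA (h x) (h y) (fun t => h (c t)) Ax Ay); [apply geodesic_image; auto|].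
  rewrite isometry_dist; auto.
Qed.

End Transport.

Lemma component_image (g h : X -> X) (Ig : isometry d g) (Ih : isometry d h)
  (gh : forall x, g (h x) = x) (hg : forall x, h (g x) = x) Y A :
  component d Y A -> component d (fun x => Y (h x)) (fun x => A (h x)).
Proof.
  intros (YA & (a & Aa) & cA & mA); split; [auto|].
  split; [exists (g a); rewrite hg; exact Aa|].
  split; [apply (connected_image g h); auto|].
  intros B YB cB (b & Ab & Bb) x Bx.
  apply (mA (fun x => B (g x))).
  - intros z Bz; rewrite <- hg; auto.
  - apply (connected_image h g); auto.
  - exists (h b); rewrite gh; auto.
  - rewrite gh; exact Bx.
Qed.

Lemma component_ext (Y Y' A : X -> Prop) : (forall x, Y x <-> Y' x) ->
  component d Y A -> component d Y' A.
Proof.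
  intros E (YA & ne & cA & mA); split; [intros x Ax; apply E; auto|].
  split; [exact ne|]. split; [exact cA|]. intros B YB; apply mA. intros x Bx; apply E; auto.
Qed.

(** The wall and the two sides of the conjugate are the images under [g] of those of [r]. *)
Lemma reflection_conj (g h : X -> X) (Ig : isometry d g) (Ih : isometry d h)
  (gh : forall x, g (h x) = x) (hg : forall x, h (g x) = x) r :
  is_reflection d r -> is_reflection d (fun x => g (r (h x))).
Proof.
  intros (Ir & rr & em & A & B & cA & cB & dis & cov & vA & vB & AB & BA).
  assert (E : forall x, ~ fixset r (h x) <-> ~ fixset (fun x => g (r (h x))) x).
  { intros x; unfold fixset; split; intros H H'; apply H.
    - rewrite <- H' at 2. rewrite hg; reflexivity.
    - rewrite H'; apply gh. }
  split; [apply (isometry_comp g (fun x => r (h x)) Ig), (isometry_comp r h); auto|].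
  split; [intros x; rewrite hg, rr; apply gh|].
  split.
  { intros U oU HU x Ux.
    apply (em (fun x => U (g x)) (open_preimage _ _ Ig oU)) with (x := h x).
    - intros y Uy. specialize (HU _ Uy). unfold fixset in *. rewrite hg in HU.
      rewrite <- (hg (r y)), HU; apply hg.
    - rewrite gh; exact Ux. }
  exists (fun x => A (h x)), (fun x => B (h x)).
  assert (img : forall A, component d (fun x => ~ fixset r x) A ->
    component d (fun x => ~ fixset (fun x => g (r (h x))) x) (fun x => A (h x))).
  { intros A' cA'. eapply component_ext; [apply E|].
    exact (component_image g h Ig Ih gh hg _ _ cA'). }
  split; [exact (img A cA)|split; [exact (img B cB)|]].
  split; [intros x; apply dis|]. split; [intros x Hx; apply cov, E; exact Hx|].
  split; [apply convex_image; auto|]. split; [apply convex_image; auto|].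
  split; intros x Hx; rewrite hg; auto.
Qed.

End Groups.

(** * Walls, chambers and half-spaces *)

Section Chambers.
Context {X : Type} {d : X -> X -> R} (HX : CAT0 d).
Context {W : (X -> X) -> Prop} {C : X -> Prop} (HW : cocompact_discrete d W C).

Lemma reflection_isometry_invol r : is_reflection d r -> isometry d r /\ forall x, r (r x) = x.
Proof. intros (I & rr & _); auto. Qed.

Lemma W_subgroup : subgroup d W.
Proof.
  destruct HW as ((G & HG & E) & _).
  assert (S : subgroup d (generated d G)).
  { apply generated_subgroup. intros t Ht; apply reflection_isometry_invol; auto. }
  destruct S as (S1 & S2 & S3 & S4); split; [|split; [|split]].
  - intros f Wf; apply S1, E; exact Wf.
  - apply E; exact S2.
  - intros f g Wf Wg; apply E, S3; apply E; assumption.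
  - intros f Wf; apply E in Wf; destruct (S4 f Wf) as (g & Wg & H).
    exists g; split; [apply E; exact Wg|exact H].
Qed.

Lemma W_isometry g : W g -> isometry d g.
Proof. apply W_subgroup. Qed.

Lemma W_comp f g : W f -> W g -> W (fun x => f (g x)).
Proof. apply W_subgroup. Qed.

Lemma W_inv f : W f -> exists g, W g /\ (forall x, g (f x) = x) /\ (forall x, f (g x) = x).
Proof. apply W_subgroup. Qed.

Lemma W_dist g x y : W g -> d (g x) (g y) = d x y.
Proof. intros Wg; apply isometry_dist, W_isometry, Wg. Qed.

Notation refl := (reflections_in d W).

Lemma refl_W r : refl r -> W r.
Proof. intros [H _]; exact H. Qed.

Lemma refl_invol r x : refl r -> r (r x) = x.
Proof. intros (_ & _ & rr & _); apply rr. Qed.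

Lemma refl_dist r x y : refl r -> d (r x) (r y) = d x y.
Proof. intros Hr; apply W_dist, refl_W, Hr. Qed.

Lemma refl_conj g h r : W g -> W h -> (forall x, g (h x) = x) -> (forall x, h (g x) = x) ->
  refl r -> refl (fun x => g (r (h x))).
Proof.
  intros Wg Wh gh hg [Wr Rr]; split.
  - apply (W_comp g (fun x => r (h x)) Wg), W_comp; assumption.
  - apply reflection_conj; auto using W_isometry.
Qed.

(** By properness only finitely many elements move [z] by less than 2, so the nonzero displacements
    of [z] have a positive lower bound. *)
Lemma moved_distance_gap z :
  exists e, 0 < e /\ forall g, W g -> g z <> z -> 2 * e <= d z (g z).
Proof.
  destruct HW as (_ & PA & _). destruct (PA z 2 ltac:(lra)) as [l Hl].
  (* The bound [e <= 1] covers the elements outside the list, whose displacement is at least 2. *)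
  assert (K : exists e, 0 < e <= 1 /\ forall g, In g l -> g z <> z -> 2 * e <= d z (g z)).
  { clear Hl. induction l as [|f l (e & He & IH)].
    - exists 1; split; [lra|]. intros g [].
    - destruct (classic (f z = z)) as [E|N].
      + exists e; split; [exact He|]. intros g [->|Hg]; [tauto|auto].
      + assert (0 < d z (f z)).
        { pose proof (dist_nonneg HX z (f z)). destruct (Req_dec (d z (f z)) 0) as [Z|]; [|lra].
          apply (dist_eq0 HX) in Z; congruence. }
        exists (Rmin e (d z (f z) / 2)); split.
        * split; [apply Rmin_glb_lt; lra|]. eapply Rle_trans; [apply Rmin_l|lra].
        * intros g [<-|Hg] Ng.
          -- pose proof (Rmin_r e (d z (f z) / 2)); lra.
          -- pose proof (Rmin_l e (d z (f z) / 2)); pose proof (IH g Hg Ng); lra. }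
  destruct K as (e & He & K). exists e; split; [lra|]. intros g Wg Ng.
  destruct (Rlt_dec (d z (g z)) 2); [apply K; auto|lra].
Qed.

Lemma refl_moves_twice r z x : refl r -> r x = x -> d z (r z) <= 2 * d z x.
Proof.
  intros Hr Hx. pose proof (dist_tri HX z x (r z)) as H.
  rewrite <- Hx in H at 2. rewrite (refl_dist _ _ _ Hr), (dist_sym HX x z) in H. lra.
Qed.

(** Local finiteness of the walls: a reflection whose wall passes close to [z] moves [z] by at most
    twice that distance, so below the displacement gap it must fix [z]. *)
Lemma wall_gap z :
  exists e, 0 < e /\ forall r x, refl r -> r z <> z -> d z x < e -> r x <> x.
Proof.
  destruct (moved_distance_gap z) as (e & e0 & He). exists e; split; [exact e0|].
  intros r x Hr Hz Hx Fx. pose proof (He r (refl_W _ Hr) Hz).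
  pose proof (refl_moves_twice _ z _ Hr Fx). lra.
Qed.

Lemma off_walls_image g x : W g -> ~ walls_union d W x -> ~ walls_union d W (g x).
Proof.
  intros Wg N (r & Hr & E). apply N. destruct (W_inv g Wg) as (h & Wh & hg & gh).
  exists (fun x => h (r (g x))). split; [apply refl_conj; auto|]. rewrite E; apply hg.
Qed.

Lemma chamber_off_walls x : C x -> ~ walls_union d W x.
Proof. destruct HW as (_ & _ & (H & _) & _); apply H. Qed.

Lemma chamber_not_fixed r x : refl r -> C x -> r x <> x.
Proof. intros Hr Cx E; apply (chamber_off_walls x Cx); exists r; auto. Qed.

(** The group permutes the walls, so maximality of the component [C] forces [g] and its inverse to
    map [C] into itself; discreteness then makes [g] trivial. *)
Lemma chamber_stabilizer_trivial g x : W g -> C x -> C (g x) -> g = fun x => x.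
Proof.
  intros Wg Cx Cgx.
  assert (sub : forall g x, W g -> C x -> C (g x) -> forall y, C y -> C (g y)).
  { clear g x Wg Cx Cgx. intros g x Wg Cx Cgx y Cy.
    destruct (W_inv g Wg) as (h & Wh & hg & gh).
    destruct HW as (_ & _ & (off & _ & cC & mC) & _).
    apply (mC (fun z => C (h z))).
    - intros z Cz. rewrite <- (gh z). apply off_walls_image; auto.
    - apply (connected_image g h); auto using W_isometry.
    - exists (g x); rewrite hg; auto.
    - rewrite hg; exact Cy. }
  apply functional_extensionality. pose proof HW as (_ & _ & _ & _ & free).
  apply free; [exact Wg|].
  destruct (W_inv g Wg) as (h & Wh & hg & gh).
  intros y; split.
  - intros Cy. exists (h y); split; [|apply gh].
    apply (sub h (g x)); auto. rewrite hg; exact Cx.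
  - intros (z & Cz & <-). eapply sub; eauto.
Qed.

(** Finitely many walls come within distance 1 of [z]. They are removed one by one: off a wall, a
    nonempty open set stays open by [wall_gap] and nonempty because walls have empty interior. *)
Lemma generic_point z e : 0 < e -> exists x, d z x < e /\ ~ walls_union d W x.
Proof.
  intros e0. destruct HW as (_ & PA & _). destruct (PA z 2 ltac:(lra)) as [l Hl].
  assert (av : forall l (U : X -> Prop), open_set d U -> (exists x, U x) ->
    exists x, U x /\ forall r, In r l -> refl r -> r x <> x).
  { clear - HX HW. intros l; induction l as [|r l IH]; intros U oU [x Ux].
    - exists x; split; [exact Ux|]. intros r [].
    - destruct (classic (refl r)) as [Hr|Nr].
      + destruct (IH (fun y => U y /\ r y <> y)) as (y & (Uy & ry) & Hy).
        * intros y (Uy & ry). destruct (oU y Uy) as (e & e0 & He).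
          destruct (wall_gap y) as (e' & e0' & He').
          exists (Rmin e e'); split; [apply Rmin_glb_lt; auto|].
          intros z Hz. pose proof (Rmin_l e e'). pose proof (Rmin_r e e').
          split; [apply He; lra|]. apply He'; auto; lra.
        * apply NNPP; intros N. destruct Hr as (_ & _ & _ & em & _).
          apply (em U oU) with (x := x); [|exact Ux].
          intros y Uy; apply NNPP; intros Hy; apply N; exists y; split; auto.
        * exists y; split; [exact Uy|]. intros s [<-|Hs]; auto.
      + destruct (IH U oU) as (y & Uy & Hy); [eauto|]. exists y; split; [exact Uy|].
        intros s [<-|Hs]; tauto || auto. }
  destruct (av l (fun x => d z x < Rmin e 1)) as (x & Hx & Hr).
  - intros x Hx. exists (Rmin e 1 - d z x); split; [lra|].
    intros y Hy. pose proof (dist_tri HX z x y); lra.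
  - exists z. rewrite (dist_refl HX). apply Rmin_glb_lt; lra.
  - pose proof (Rmin_l e 1). pose proof (Rmin_r e 1).
    exists x; split; [lra|]. intros (r & Rr & Fx). apply (Hr r); auto.
    apply Hl; [apply refl_W; exact Rr|]. pose proof (refl_moves_twice _ z _ Rr Fx). lra.
Qed.

Lemma chamber_nonempty : exists c, C c.
Proof. destruct HW as (_ & _ & (_ & H & _) & _); exact H. Qed.

(** The chamber is connected and misses the wall of [r], so it lies in one of the two sides provided
    by the definition of a reflection, and [Xplus d r C] equals that side. *)
Lemma half_space r : refl r ->
  component d (fun y => ~ fixset r y) (Xplus d r C) /\ convex d (Xplus d r C) /\
  (forall x, C x -> Xplus d r C x) /\
  (forall x, r x <> x -> Xplus d r C x \/ Xplus d r C (r x)) /\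
  (forall x, Xplus d r C x -> ~ Xplus d r C (r x)).
Proof.
  intros Hr. destruct chamber_nonempty as [c0 Hc].
  pose proof Hr as (_ & _ & _ & _ & A & B & cA & cB & dis & cov & vA & vB & AB & BA).
  assert (K : forall A, component d (fun y => ~ fixset r y) A -> A c0 ->
    Xplus d r C = A /\ forall x, C x -> A x).
  { clear - HX HW Hr Hc. intros A cA Ac.
    assert (CA : forall x, C x -> A x).
    { pose proof cA as (_ & _ & _ & mA). pose proof HW as (_ & _ & (_ & _ & cC & _) & _).
      apply mA; [intros x Cx; apply chamber_not_fixed; auto|exact cC|eauto]. }
    split; [|exact CA]. apply functional_extensionality; intros x.
    apply propositional_extensionality; split.
    - intros (A' & cA' & CA' & Ax).
      exact (component_eq (d := d) _ A' A c0 cA' cA (CA' _ Hc) Ac x Ax).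
    - intros Ax; exists A; auto. }
  destruct (cov c0) as [Ac|Bc].
  - apply chamber_not_fixed; auto.
  - destruct (K A cA Ac) as [-> CA]. repeat (split; [assumption|]). split.
    + intros x Nx; destruct (cov x Nx); auto.
    + intros x Ax Arx; apply (dis (r x)); auto.
  - destruct (K B cB Bc) as [-> CB]. repeat (split; [assumption|]). split.
    + intros x Nx; destruct (cov x Nx); auto.
    + intros x Bx Brx; apply (dis (r x)); auto.
Qed.

Lemma Xplus_not_fixed r x : refl r -> Xplus d r C x -> r x <> x.
Proof. intros Hr Px. destruct (half_space r Hr) as ((H & _) & _). exact (H x Px). Qed.

Lemma Xplus_segment r c x y : refl r -> geodesic d c x y -> Xplus d r C x ->
  (forall t, 0 <= t <= d x y -> r (c t) <> c t) -> Xplus d r C y.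
Proof.
  intros Hr G Px H. destruct (half_space r Hr) as (cP & _).
  exact (component_segment HX _ _ _ _ _ cP Px G H).
Qed.

Lemma wall_crossing r c x y : refl r -> geodesic d c x y -> Xplus d r C x -> ~ Xplus d r C y ->
  exists t, 0 <= t <= d x y /\ r (c t) = c t.
Proof.
  intros Hr G Px Ny. apply NNPP; intros N. apply Ny.
  apply (Xplus_segment r c x y); auto. intros t Ht E; apply N; eauto.
Qed.

Lemma Xplus_ball z : exists e, 0 < e /\
  forall r x, refl r -> Xplus d r C z -> d z x < e -> Xplus d r C x.
Proof.
  destruct (wall_gap z) as (e & e0 & He). exists e; split; [exact e0|].
  intros r x Hr Pz Hx. destruct (half_space r Hr) as (cP & _).
  eapply (component_ball HX); eauto. intros y Hy; apply He; auto. apply Xplus_not_fixed; auto.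
Qed.

(* The closed half-space of [r] containing [C]: the complement of the open one opposite to [C]. *)
Definition Hplus (r : X -> X) (x : X) : Prop := ~ Xplus d r C (r x).

Lemma Xplus_Hplus r x : refl r -> Xplus d r C x -> Hplus r x.
Proof. intros Hr; apply half_space; exact Hr. Qed.

Lemma Hplus_Xplus r x : refl r -> Hplus r x -> r x <> x -> Xplus d r C x.
Proof.
  intros Hr Hx Nx. destruct (half_space r Hr) as (_ & _ & _ & cov & _).
  destruct (cov x Nx) as [P|P]; [exact P|destruct (Hx P)].
Qed.

Lemma Hplus_closed r x : refl r -> closure d (Hplus r) x -> Hplus r x.
Proof.
  intros Hr Hx Px. destruct (Xplus_ball (r x)) as (e & e0 & He).
  destruct (Hx e e0) as (y & Hy & Dy). apply Hy, He; auto. rewrite refl_dist; auto.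
Qed.

Lemma opposite_crossing r c x y : refl r -> geodesic d c x y -> Xplus d r C (r x) -> Hplus r y ->
  exists t, 0 <= t <= d x y /\ r (c t) = c t.
Proof.
  intros Hr G Px Hy.
  destruct (wall_crossing r (fun t => r (c t)) (r x) (r y)) as (t & Ht & E); auto.
  - apply geodesic_image; auto. apply W_isometry, refl_W, Hr.
  - rewrite refl_dist in Ht by exact Hr. rewrite !refl_invol in E by exact Hr. eauto.
Qed.

(** A geodesic straying to the open opposite side at time [t] meets the wall before and after [t].
    Between these two fixed points it equals its own mirror image by uniqueness, so the point at
    time [t] is fixed: a contradiction. *)
Lemma Hplus_convex r : refl r -> convex d (Hplus r).
Proof.
  intros Hr x y c Hx Hy G t Ht Pt.
  assert (cx : c 0 = x) by apply G. assert (cy : c (d x y) = y) by apply G.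
  assert (H1 : exists t1, 0 <= t1 <= t /\ r (c t1) = c t1).
  { pose proof (geodesic_sub _ _ _ 0 t G) as G1. rewrite cx in G1.
    apply (geodesic_rev HX) in G1; try lra.
    destruct (opposite_crossing _ _ _ _ Hr G1 Pt Hx) as (u & Hu & E).
    rewrite (dist_sym HX), (geodesic_dist_start _ _ _ _ G Ht) in Hu.
    rewrite (geodesic_dist_start _ _ _ _ G Ht) in E.
    exists (0 + (t - u)); split; [lra|exact E]. }
  assert (H2 : exists t2, t <= t2 <= d x y /\ r (c t2) = c t2).
  { pose proof (geodesic_sub _ _ _ t (d x y) G) as G2. rewrite cy in G2.
    destruct (opposite_crossing _ _ _ _ Hr (G2 ltac:(lra) ltac:(lra)) Pt Hy) as (u & Hu & E).
    rewrite (geodesic_dist_end _ _ _ _ G Ht) in Hu.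
    exists (t + u); split; [lra|exact E]. }
  destruct H1 as (t1 & Ht1 & E1), H2 as (t2 & Ht2 & E2).
  assert (G1 : geodesic d (fun u => c (t1 + u)) (c t1) (c t2))
    by (apply (geodesic_sub c x y); auto; lra).
  pose proof (geodesic_image _ _ _ _ (W_isometry r (refl_W r Hr)) G1) as G2.
  rewrite E1, E2 in G2.
  assert (E : c t = r (c t)).
  { replace t with (t1 + (t - t1)) by ring.
    apply (geodesic_unique HX _ _ _ _ (t - t1) G1 G2).
    rewrite (geodesic_dist _ _ _ _ _ G) by lra. rewrite Rabs_left1; lra. }
  apply (Xplus_not_fixed _ _ Hr Pt). rewrite refl_invol by exact Hr. exact E.
Qed.

(** * Folding points towards the chamber *)

Lemma list_min {A : Type} (P : A -> Prop) (f : A -> R) (l : list A) (a0 : A) : P a0 ->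
  exists a, P a /\ f a <= f a0 /\ forall b, In b l -> P b -> f a <= f b.
Proof.
  intros P0; induction l as [|b l (a & Pa & Ha & IH)].
  - exists a0; split; [exact P0|split; [lra|intros b []]].
  - destruct (classic (P b /\ f b < f a)) as [[Pb Hb]|N].
    + exists b; split; [exact Pb|split; [lra|]].
      intros b' [<-|Hb'] Pb'; [lra|]. pose proof (IH b' Hb' Pb'); lra.
    + exists a; split; [exact Pa|split; [exact Ha|]].
      intros b' [<-|Hb'] Pb'; [|auto]. apply Rnot_lt_le; tauto.
Qed.

Lemma generated_W (T : (X -> X) -> Prop) g : (forall t, T t -> refl t) -> generated d T g -> W g.
Proof. intros HT Hg; apply Hg; [apply W_subgroup|]. intros t Ht; apply refl_W; auto. Qed.

(* Reflecting the part of [[c0,x]] beyond the wall gives a path of the same length touching the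
   wall, which a geodesic between points of an open half-space cannot do. *)
Lemma reflect_closer t x c0 : refl t -> C c0 -> ~ Hplus t x -> d c0 (t x) < d c0 x.
Proof.
  intros Ht Hc Nx. apply NNPP in Nx.
  destruct (half_space t Ht) as (_ & cvx & CP & _ & anti).
  assert (Nx' : ~ Xplus d t C x) by (intros Px; exact (anti x Px Nx)).
  destruct (geodesic_exists HX c0 x) as [c G].
  destruct (wall_crossing _ _ _ _ Ht G (CP _ Hc) Nx') as (u & Hu & Eu).
  set (p := c u) in *.
  assert (D1 : d c0 p = u) by (apply (geodesic_dist_start _ _ _ _ G Hu)).
  assert (D2 : d p (t x) = d c0 x - u).
  { rewrite <- Eu, (refl_dist _ _ _ Ht). apply (geodesic_dist_end _ _ _ _ G Hu). }
  apply Rnot_le_lt; intros Hle.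
  destruct (geodesic_exists HX c0 (t x)) as [c' G'].
  assert (Ep : c' u = p).
  { apply (geodesic_through HX c' c0 (t x) p u G'); [exact D1|].
    pose proof (dist_tri HX c0 p (t x)). lra. }
  apply (Xplus_not_fixed t p Ht); [|exact Eu]. rewrite <- Ep.
  apply (cvx c0 (t x) c'); auto. pose proof (dist_nonneg HX p (t x)). lra.
Qed.

(** Choose [g] so that [g z] is nearest to a chamber point [c0]; if [g z] were beyond the wall of
    some [t], applying [t] would bring it nearer. *)
Lemma fold_exists (T : (X -> X) -> Prop) z : (forall t, T t -> refl t) ->
  exists g, generated d T g /\ forall t, T t -> Hplus t (g z).
Proof.
  intros HT. destruct chamber_nonempty as [c0 Hc].
  assert (S : subgroup d (generated d T)).
  { apply generated_subgroup. intros t Ht; apply reflection_isometry_invol, HT, Ht. }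
  pose proof HW as (_ & PA & _). pose proof (dist_nonneg HX c0 z) as N0.
  (* An element taking [z] no farther from [c0] than it was moves [c0] by at most [2 * d c0 z], so
     the minimum is over a finite list. *)
  destruct (PA c0 (2 * d c0 z + 1) ltac:(lra)) as [l Hl].
  destruct (list_min (generated d T) (fun g => d c0 (g z)) l (fun x => x)) as (g & Hg & H1 & H2).
  { apply S. }
  exists g; split; [exact Hg|]. intros t Ht. apply NNPP; intros N.
  pose proof (reflect_closer t (g z) c0 (HT t Ht) Hc N) as Hlt.
  assert (Htg : generated d T (fun x => t (g x))).
  { apply (proj1 (proj2 (proj2 S))); [apply generated_base; exact Ht|exact Hg]. }
  pose proof (generated_W T _ HT Htg) as Wtg.
  apply (Rlt_not_le _ _ Hlt). apply (H2 (fun x => t (g x))); [|exact Htg].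
  apply Hl; [exact Wtg|].
  pose proof (dist_tri HX c0 (t (g z)) (t (g c0))) as H3.
  pose proof (W_dist _ z c0 Wtg) as H4. cbv beta in H4. rewrite (dist_sym HX z c0) in H4. lra.
Qed.

Lemma generated_fixes (T : (X -> X) -> Prop) z g : (forall t, T t -> refl t) ->
  (forall t, T t -> t z = z) -> generated d T g -> g z = z.
Proof.
  intros HT Hz Hg. assert (Ht : forall t, T t -> isometry d t /\ forall x, t (t x) = x).
  { intros t Ht; apply reflection_isometry_invol, HT, Ht. }
  destruct (proj1 (generated_word T Ht g) Hg) as (l & Hl & E). rewrite E. clear E.
  induction Hl as [|t l Tt _ IH]; [reflexivity|]. simpl. rewrite IH; auto.
Qed.

(** A translate of the chamber meets no wall, so it lies on one side of each. *)
Lemma chamber_side g r x y : convex d C -> W g -> refl r -> C x -> C y ->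
  Xplus d r C (g x) -> Xplus d r C (g y).
Proof.
  intros vC Wg Hr Cx Cy Px. destruct (geodesic_exists HX x y) as [c G].
  apply (Xplus_segment r (fun t => g (c t)) (g x)); auto.
  - apply geodesic_image; auto using W_isometry.
  - rewrite (W_dist g) by exact Wg. intros t Ht E.
    apply (off_walls_image g (c t) Wg); [|exists r; auto].
    apply chamber_off_walls. apply (vC x y); auto.
Qed.

(** * The chamber as seen from its minimal set of walls *)

Section Basis.
Context {S : (X -> X) -> Prop} (HS : minimal_basis d W C S).

Lemma basis_refl s : S s -> refl s.
Proof. exact (proj1 HS s). Qed.

Lemma chamber_iff x : C x <-> forall s, S s -> Xplus d s C x.
Proof. exact (proj1 (proj2 HS) x). Qed.

Lemma chamber_convex : convex d C.
Proof.
  intros x y c Cx Cy G t Ht. apply chamber_iff. intros s Ss.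
  destruct (half_space s (basis_refl s Ss)) as (_ & cvx & CP & _).
  apply (cvx x y c); auto.
Qed.

(* Geodesics may branch along a wall, so segments from [z] to the chamber need not enter
   it at once; instead a generic point near [z] is folded into the chamber by reflections
   fixing [z]. *)
Lemma closure_chamber z : (forall s, S s -> Hplus s z) -> closure d C z.
Proof.
  intros Hz e e0. destruct (Xplus_ball z) as (e' & e0' & He').
  destruct (generic_point z (Rmin e e')) as (x & Dx & Ox); [apply Rmin_glb_lt; auto|].
  set (T := fun s => S s /\ s z = z).
  assert (HT : forall t, T t -> refl t) by (intros t [Ht _]; apply basis_refl, Ht).
  destruct (fold_exists T x HT) as (g & Hg & Fg).
  assert (Wg : W g) by (apply (generated_W T); auto).
  assert (gz : g z = z).
  { apply (generated_fixes T); auto. intros t [_ Ht]; exact Ht. }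
  pose proof (W_dist g z x Wg) as Dg; rewrite gz in Dg.
  pose proof (Rmin_l e e'). pose proof (Rmin_r e e').
  exists (g x); split; [|lra]. apply chamber_iff. intros s Ss.
  pose proof (basis_refl s Ss) as Hs.
  (* The folding handles the walls through [z]; for the others, [g x] is too close to [z] to have
     changed side. *)
  destruct (classic (s z = z)) as [E|N].
  - apply Hplus_Xplus; auto.
    + apply Fg; split; auto.
    + intros E'. apply (off_walls_image g x Wg Ox). exists s; auto.
  - apply He'; [exact Hs| |lra]. apply Hplus_Xplus; auto.
Qed.

(** By minimality some [x] satisfies all conditions except that of [s]; the segment from the chamber
    to [x] meets the wall of [s] at [p]. Near [p], every point off that wall lies in [C] or [sC]. A
    reflection [r] fixing [p] sends a nearby chamber point there, so [r] or [sr] is trivial, and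
    only the latter is possible. *)
Lemma panel_point s : S s -> exists p, s p = p /\ (forall e, 0 < e -> exists x, C x /\ d p x < e) /\
  forall r, refl r -> r p = p -> r = s.
Proof.
  intros Ss. pose proof (basis_refl s Ss) as Hs.
  assert (Hx : exists x, (forall s', S s' -> s' <> s -> Xplus d s' C x) /\ ~ Xplus d s C x).
  { apply NNPP; intros N. destruct HS as (_ & _ & mn).
    apply (mn (fun s' => S s' /\ s' <> s)) in Ss; [tauto|tauto|].
    intros x; split; [intros Cx s' [Ss' _]; apply chamber_iff; auto|].
    intros H. apply chamber_iff. intros s' Ss'. destruct (classic (s' = s)) as [->|Ne].
    - apply NNPP; intros Nx. apply N; exists x; split; [|exact Nx]. intros; apply H; auto.
    - apply H; auto. }
  destruct Hx as (x & Hx & Nx). destruct chamber_nonempty as [c0 Hc].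
  destruct (geodesic_exists HX c0 x) as [c G].
  destruct (wall_crossing s c c0 x Hs G) as (u & Hu & Eu); auto.
  { apply chamber_iff; auto. }
  set (p := c u) in *.
  assert (Pp : forall s', S s' -> s' <> s -> Xplus d s' C p).
  { intros s' Ss' Ne. destruct (half_space s' (basis_refl s' Ss')) as (_ & cvx & CP & _).
    apply (cvx c0 x c); auto. }
  destruct (Xplus_ball p) as (e & e0 & He).
  assert (near : forall y, d p y < e -> Xplus d s C y -> C y).
  { intros y Dy Py. apply chamber_iff. intros s' Ss'.
    destruct (classic (s' = s)) as [->|Ne]; [exact Py|]. apply He; auto using basis_refl. }
  assert (side : forall y, d p y < e -> s y <> y -> C y \/ C (s y)).
  { intros y Dy Ny. destruct (half_space s Hs) as (_ & _ & _ & cov & _).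
    destruct (cov y Ny); [left; auto|right; apply near; auto].
    rewrite <- Eu, refl_dist; auto. }
  exists p.
  assert (dense : forall e', 0 < e' -> exists y, C y /\ d p y < e').
  { intros e' e0'. destruct (generic_point p (Rmin e e')) as (y & Dy & Oy).
    { apply Rmin_glb_lt; auto. }
    pose proof (Rmin_l e e'). pose proof (Rmin_r e e').
    destruct (side y) as [Cy|Cy]; [lra| | |].
    - intros E; apply Oy; exists s; auto.
    - exists y; split; [exact Cy|lra].
    - exists (s y); split; [exact Cy|]. rewrite <- Eu, refl_dist; [lra|exact Hs]. }
  split; [exact Eu|split; [exact dense|]].
  intros r Hr Er. destruct (dense e e0) as (y & Cy & Dy).
  assert (Or : ~ walls_union d W (r y)).
  { apply off_walls_image; [apply refl_W, Hr|apply chamber_off_walls, Cy]. }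
  destruct (side (r y)) as [Cr|Cr].
  - rewrite <- Er, refl_dist; auto.
  - intros E; apply Or; exists s; auto.
  - exfalso. apply (chamber_not_fixed r y Hr Cy).
    rewrite (chamber_stabilizer_trivial r y); auto. apply refl_W, Hr.
  - assert (E : (fun x => s (r x)) = fun x => x).
    { apply (chamber_stabilizer_trivial _ y); auto. apply W_comp; apply refl_W; auto. }
    apply functional_extensionality; intros v. rewrite <- (refl_invol s (r v) Hs).
    exact (f_equal s (f_equal (fun f => f v) E)).
Qed.

(** A chamber point [y] near the panel point [p] and its mirror image [s y] are joined by a short
    segment, which the wall of [r] must cross; by local finiteness that wall passes through [p]. *)
Lemma separated_from_neighbour s r x : S s -> refl r -> C x -> ~ Xplus d r C (s x) -> r = s.
Proof.
  intros Ss Hr Cx Nx. pose proof (basis_refl s Ss) as Hs.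
  destruct (panel_point s Ss) as (p & sp & dense & only). apply only; [exact Hr|].
  apply NNPP; intros Np. destruct (wall_gap p) as (e & e0 & He).
  (* Points of the segment from [y] to [s y] are within [3 * d p y] of [p]. *)
  destruct (dense (e / 3) ltac:(lra)) as (y & Cy & Dy).
  assert (Ny : ~ Xplus d r C (s y)).
  { intros Py; apply Nx. apply (chamber_side s r y x); auto using refl_W, chamber_convex. }
  destruct (geodesic_exists HX y (s y)) as [c G].
  destruct (half_space r Hr) as (_ & _ & CP & _).
  destruct (wall_crossing r c y (s y) Hr G (CP y Cy) Ny) as (u & Hu & Eu).
  apply (He r (c u)); auto.
  pose proof (geodesic_dist_start _ _ _ _ G Hu).
  pose proof (dist_tri HX p y (c u)). pose proof (dist_tri HX y p (s y)).
  assert (d p (s y) = d p y) by (rewrite <- sp at 1; apply refl_dist; auto).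
  rewrite (dist_sym HX y p) in *. lra.
Qed.

(** * Words over [T]: exchange and deletion *)

Section Parabolic.
Context {T : (X -> X) -> Prop} (HT : forall t, T t -> S t).

Lemma parabolic_refl t : T t -> refl t.
Proof. intros Ht; apply basis_refl, HT, Ht. Qed.

Lemma parabolic_gen t : T t -> isometry d t /\ forall x, t (t x) = x.
Proof. intros Ht; apply reflection_isometry_invol, parabolic_refl, Ht. Qed.

Lemma parabolic_subgroup : subgroup d (generated d T).
Proof. exact (generated_subgroup T parabolic_gen). Qed.

Lemma parabolic_W g : generated d T g -> W g.
Proof. apply generated_W. exact parabolic_refl. Qed.

(** Induction on the word. If [r] is the first letter [t], that letter cancels. Otherwise [r] does
    not separate [C] from [tC], so the conjugate [trt] separates [C] from its translate by the
    remaining word. *)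
Lemma exchange l r x : Forall T l -> refl r -> C x -> ~ Xplus d r C (word l x) ->
  exists l', Forall T l' /\ length l = (1 + length l')%nat /\
    forall y, r (word l y) = word l' y.
Proof.
  intros Hl Hr Cx. revert r Hr. induction Hl as [|t l Ht Hl IH]; intros r Hr Nx.
  - destruct Nx. apply half_space; auto.
  - pose proof (parabolic_refl t Ht) as Rt.
    destruct (classic (r = t)) as [->|Ne].
    + exists l; split; [exact Hl|split; [reflexivity|]].
      intros y. exact (refl_invol t (word l y) Rt).
    + assert (Pt : Xplus d r C (t x)).
      { apply NNPP; intros N. apply Ne. apply (separated_from_neighbour t r x); auto. }
      assert (Hr' : refl (fun y => t (r (t y)))).
      { apply refl_conj; auto using refl_W; intros; apply refl_invol, Rt. }
      destruct (IH (fun y => t (r (t y))) Hr') as (l' & Hl' & len & E).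
      { intros P. apply Nx. simpl.
        destruct (half_space _ Hr') as (_ & cvx & CP & _).
        destruct (geodesic_exists HX x (word l x)) as [c G].
        apply (Xplus_segment r (fun u => t (c u)) (t x)); auto.
        - apply geodesic_image; auto. apply W_isometry, refl_W, Rt.
        - rewrite (refl_dist t) by exact Rt. intros u Hu Eu.
          apply (Xplus_not_fixed _ (c u) Hr').
          + apply (cvx x (word l x) c); auto.
          + rewrite Eu; apply refl_invol, Rt. }
      exists (t :: l'); split; [auto|split; [simpl; lia|]].
      intros y; simpl. rewrite <- E, refl_invol by exact Rt. reflexivity.
Qed.

(** The first letter [t] of a nonempty word separates [C] from its translate by the tail, so
    exchange replaces the word by one two letters shorter with the same action. *)
Lemma unseparated_trivial l x : Forall T l -> C x ->
  (forall t, T t -> Xplus d t C (word l x)) -> forall y, word l y = y.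
Proof.
  intros Hl Cx. remember (length l) as n eqn:En. revert l Hl En.
  induction n as [n IH] using (well_founded_induction Wf_nat.lt_wf); intros l Hl En HP.
  destruct Hl as [|t l Ht Hl]; [reflexivity|].
  pose proof (parabolic_refl t Ht) as Rt.
  destruct (exchange l t x Hl Rt Cx) as (l' & Hl' & len & E).
  { intros P. destruct (half_space t Rt) as (_ & _ & _ & _ & anti).
    apply (anti _ P). apply (HP t Ht). }
  intros y. simpl. rewrite E. simpl in En.
  apply (IH (length l') ltac:(lia) l'); auto. intros t' Ht'. rewrite <- E. exact (HP t' Ht').
Qed.

(** If [s] separated [C] from [gC], exchange would write [s] as a word over [T]. No [t] in [T]
    separates [C] from [sC], since it would equal [s], so this word would be trivial, whereas [s]
    moves the points of [C]. *)
Lemma parabolic_side g s x : generated d T g -> S s -> ~ T s -> C x -> Xplus d s C (g x).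
Proof.
  intros Hg Ss Ns Cx. apply NNPP; intros N. pose proof (basis_refl s Ss) as Rs.
  apply (generated_word _ parabolic_gen) in Hg as (l & Hl & ->).
  destruct (exchange l s x Hl Rs Cx N) as (l' & Hl' & _ & E).
  assert (Hr : Forall T (rev l)) by (apply Forall_rev, Hl).
  assert (Es : forall y, s y = word (l' ++ rev l) y).
  { intros y. rewrite word_app, <- E. f_equal. symmetry.
    rewrite <- (rev_involutive l) at 1. apply (word_rev _ parabolic_gen); exact Hr. }
  apply (chamber_not_fixed s x Rs Cx). rewrite Es.
  apply (unseparated_trivial _ x); [apply Forall_app; auto|exact Cx|].
  intros t Ht. rewrite <- Es. apply NNPP; intros N'. apply Ns.
  rewrite <- (separated_from_neighbour s t x); auto using parabolic_refl.
Qed.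

(** * Convexity and completeness of the union of translates *)

Notation Y := (translates d (generated d T) C).

(** Forwards, [parabolic_side] passes to the closed chamber because the half-spaces are closed.
    Backwards, folding [z] by the group of [T] secures the half-spaces of [T], and the hypothesis
    supplies those of the other elements of [S]. *)
Lemma translates_iff z : Y z <->
  forall g s, generated d T g -> S s -> ~ T s -> Hplus s (g z).
Proof.
  destruct parabolic_subgroup as (_ & _ & comp & inv). split.
  - intros (h & x & Hh & Hx & <-) g s Hg Ss Ns. pose proof (basis_refl s Ss) as Rs.
    apply Hplus_closed; [exact Rs|]. intros e e0. destruct (Hx e e0) as (y & Cy & Dy).
    pose proof (comp g h Hg Hh) as Hgh.
    exists (g (h y)); split.
    + apply Xplus_Hplus; [exact Rs|]. apply (parabolic_side (fun x => g (h x))); auto.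
    + rewrite !W_dist by (apply parabolic_W; assumption). exact Dy.
  - intros H. destruct (fold_exists T z parabolic_refl) as (g & Hg & Fg).
    destruct (inv g Hg) as (h & Hh & hg & gh).
    exists h, (g z). split; [exact Hh|split; [|apply hg]].
    apply closure_chamber. intros s Ss. destruct (classic (T s)); auto.
Qed.

Lemma translates_convex : convex d Y.
Proof.
  intros x y c Yx Yy G t Ht. apply translates_iff. intros g s Hg Ss Ns.
  pose proof (parabolic_W g Hg) as Wg.
  apply (Hplus_convex s (basis_refl s Ss) (g x) (g y) (fun t => g (c t))).
  - apply translates_iff; auto.
  - apply translates_iff; auto.
  - apply geodesic_image; auto using W_isometry.
  - rewrite W_dist; auto.
Qed.

Lemma translates_image g z : generated d T g -> Y z -> Y (g z).
Proof.
  intros Hg (h & x & Hh & Hx & <-). exists (fun x => g (h x)), x.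
  split; [|auto]. apply (proj1 (proj2 (proj2 parabolic_subgroup))); auto.
Qed.

Lemma translates_chamber c0 : C c0 -> Y c0.
Proof.
  intros Hc. exists (fun x => x), c0. split; [apply parabolic_subgroup|split; [|reflexivity]].
  intros e e0; exists c0; rewrite (dist_refl HX); auto.
Qed.

Lemma chamber_closure_compact : compact d (closure d C).
Proof. apply HW. Qed.

(** By properness finitely many translates contain the tail of the sequence, so one of them contains
    infinitely many terms; pulled back to the compact closed chamber, the sequence converges. *)
Lemma translates_complete u : cauchy (d := d) u -> (exists N, forall n, (N <= n)%nat -> Y (u n)) ->
  exists z, Y z /\ converges (d := d) u z.
Proof.
  intros cu [N0 HY]. destruct chamber_nonempty as [c0 Hc].
  destruct (compact_bounded HX _ c0 chamber_closure_compact) as (M & M0 & HM).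
  destruct (cu 1 ltac:(lra)) as [N1 HN1]. set (N := max N0 N1).
  destruct HW as (_ & PA & _). pose proof (dist_nonneg HX c0 (u N)).
  (* The path from [c0] through [u N] and [u n] to [g c0]: the first 1 bounds the tail, [M] the
     chamber, and the last 1 is slack. *)
  destruct (PA c0 (d c0 (u N) + 1 + M + 1) ltac:(lra)) as [l Hl].
  set (P := fun (g : X -> X) n => generated d T g /\ exists x, closure d C x /\ g x = u n).
  assert (HP : forall n, (N <= n)%nat -> exists g, In g l /\ P g n).
  { intros n Hn. destruct (HY n ltac:(lia)) as (g & x & Hg & Hx & E).
    exists g; split; [|split; eauto]. apply Hl; [apply parabolic_W, Hg|].
    pose proof (HN1 N n ltac:(lia) ltac:(lia)). pose proof (HM x Hx).
    pose proof (W_dist g c0 x (parabolic_W g Hg)) as H3. rewrite E in H3.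
    pose proof (dist_tri HX c0 (u N) (g c0)). pose proof (dist_tri HX (u N) (u n) (g c0)).
    rewrite (dist_sym HX (u n) (g c0)) in *. lra. }
  assert (freq : exists g, forall K, exists n, (K <= n)%nat /\ P g n).
  { apply NNPP; intros Nf. destruct (list_eventually (fun g n => ~ P g n) l) as [K HK].
    - intros g _. apply NNPP; intros Ng. apply Nf. exists g. intros K.
      apply NNPP; intros Nn. apply Ng. exists K. intros n Hn Pn. apply Nn; eauto.
    - destruct (HP (max K N) ltac:(lia)) as (g & Hg & Pg). apply (HK (max K N) g); auto. lia. }
  destruct freq as [g Hg].
  assert (Gg : generated d T g) by (destruct (Hg O) as (n & _ & H1 & _); auto).
  pose proof parabolic_subgroup as (_ & _ & _ & inv).
  destruct (inv g Gg) as (h & Gh & hg & gh).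
  destruct (compact_cauchy HX _ (fun n => h (u n)) chamber_closure_compact) as (z & Hz & conv).
  - intros e e0. destruct (cu e e0) as [K HK]. exists K. intros n m Hn Hm.
    rewrite (W_dist h) by (apply parabolic_W, Gh). auto.
  - intros K. destruct (Hg K) as (n & Hn & _ & x & Hx & E). exists n; split; [exact Hn|].
    rewrite <- E, hg. exact Hx.
  - exists (g z); split; [exists g, z; auto|]. intros e e0. destruct (conv e e0) as [K HK].
    exists K. intros n Hn. rewrite <- (gh (u n)), (W_dist g) by (apply parabolic_W, Gg). auto.
Qed.

Lemma translates_closed z : closure d Y z -> Y z.
Proof.
  intros Hz.
  assert (Hu : forall n, exists y, Y y /\ d z y < / INR (Datatypes.S n)).
  { intros n. apply Hz. apply Rinv_0_lt_compat, lt_0_INR; lia. }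
  apply choice in Hu as [u Hu].
  assert (conv : converges (d := d) u z).
  { intros e e0. destruct (archimed_cor1 e e0) as (N & HN & Npos). exists N. intros n Hn.
    rewrite (dist_sym HX). eapply Rlt_trans; [apply Hu|]. eapply Rle_lt_trans; [|exact HN].
    apply Rinv_le_contravar; [apply lt_0_INR; lia|apply le_INR; lia]. }
  destruct (translates_complete u) as (y & Yy & conv').
  - intros e e0. destruct (conv (e / 2) ltac:(lra)) as [N HN]. exists N. intros n m Hn Hm.
    pose proof (HN n Hn). pose proof (HN m Hm). pose proof (dist_tri HX (u n) z (u m)).
    rewrite (dist_sym HX z (u m)) in *. lra.
  - exists O; intros n _; apply Hu.
  - replace z with y; [exact Yy|]. apply (dist_eq0 HX).
    apply (converges_dist HX u u y z conv' conv 0 O). intros; apply (dist_refl HX).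
Qed.

(** * Limit set, boundary and convex cocompactness *)

Lemma limit_ray_boundary x0 xi :
  limit_ray d (generated d T) x0 xi -> boundary_ray d Y x0 xi.
Proof.
  intros (Hr & H0 & Hc). split; [exact Hr|split; [exact H0|]].
  destruct chamber_nonempty as [c0 Cc].
  apply (shadow_ray HX Y xi c0 (d x0 c0 + 1) translates_convex translates_complete Hr).
  { apply translates_chamber, Cc. }
  intros n. destruct n as [|n].
  (* Time 0 is separate because [cone_closure] speaks of positive radii only. *)
  { exists c0; split; [apply translates_chamber, Cc|]. simpl INR. rewrite H0; lra. }
  set (r := INR (Datatypes.S n)). assert (r0 : 0 < r) by (apply lt_0_INR; lia).
  destruct (Hc r 1 r0 ltac:(lra)) as (a & c & (g & Hg & <-) & Hlt & G & Hd).
  (* The base point [x0] may lie outside [Y], so the segment from [x0] to [g x0] is replaced by the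
     one from [c0] to [g c0], which lies in [Y] and stays within [d x0 c0] of it. *)
  destruct (geodesic_exists HX c0 (g c0)) as [c' G'].
  set (l := r / d x0 (g x0)).
  assert (Hl : 0 <= l <= 1) by (apply ratio_bounds; lra).
  pose proof (quadrilateral HX _ _ _ _ _ _ l G G' Hl) as H1.
  rewrite (W_dist g) in H1 by (apply parabolic_W, Hg).
  replace (l * d x0 (g x0)) with r in H1 by (unfold l; field; lra).
  exists (c' (l * d c0 (g c0))). pose proof (dist_nonneg HX c0 (g c0)). split.
  - apply (translates_convex c0 (g c0) c'); auto.
    + apply translates_chamber, Cc.
    + apply translates_image; [exact Hg|]. apply translates_chamber, Cc.
    + nra.
  - pose proof (dist_tri HX (xi r) (c r) (c' (l * d c0 (g c0)))).
    rewrite (dist_sym HX (xi r) (c r)) in *. lra.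
Qed.

(** Each [eta n] lies in a translate of the closed chamber, so some orbit point is within a fixed
    distance [D] of [xi n]; geodesics from [x0] to these two points are close at time [r] once [n]
    is large. *)
Lemma boundary_ray_limit x0 xi :
  boundary_ray d Y x0 xi -> limit_ray d (generated d T) x0 xi.
Proof.
  intros (Hr & H0 & eta & _ & HY & K & HK). split; [exact Hr|split; [exact H0|]].
  intros r e r0 e0.
  destruct (compact_bounded HX _ x0 chamber_closure_compact) as (M & M0 & HM).
  pose proof (HK 0 (Rle_refl 0)). pose proof (dist_nonneg HX (xi 0) (eta 0)).
  set (D := M + K). assert (D0 : 0 <= D) by (unfold D; lra).
  assert (P : 0 <= 2 * r * D / e) by (apply Rle_mult_inv_pos; nra).
  (* Large enough that the orbit point is farther than [r] from [x0] and that
     [2 * r * D / n < e]. *)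
  set (n := r + D + 1 + 2 * r * D / e). assert (n0 : 0 < n) by (unfold n; lra).
  destruct (HY n ltac:(lra)) as (g & x & Hg & Hx & E).
  destruct (geodesic_exists HX x0 (g x0)) as [c G].
  assert (Da : d (xi n) (g x0) <= D).
  { pose proof (HK n ltac:(lra)). pose proof (HM x Hx).
    pose proof (W_dist g x0 x (parabolic_W g Hg)) as Dg. rewrite E in Dg.
    pose proof (dist_tri HX (xi n) (eta n) (g x0)).
    rewrite (dist_sym HX (eta n) (g x0)) in *. unfold D; lra. }
  pose proof (ray_geodesic xi n Hr ltac:(lra)) as Gx. rewrite H0 in Gx.
  pose proof (ray_dist0 xi n Hr ltac:(lra)) as Dn. rewrite H0 in Dn.
  assert (Hlt : r < d x0 (g x0)).
  { pose proof (dist_tri HX x0 (g x0) (xi n)). rewrite (dist_sym HX (g x0) (xi n)) in *.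
    unfold n in *; lra. }
  exists (g x0), c. split; [eauto|split; [exact Hlt|split; [exact G|]]].
  pose proof (geodesics_from_point_at HX _ _ _ _ _ r Gx G) as Hr'. rewrite Dn in Hr'.
  rewrite (dist_sym HX). eapply Rle_lt_trans; [apply Hr'; unfold n in *; lra|].
  apply Rmult_lt_reg_r with n; [exact n0|].
  replace (2 * (r / n) * d (xi n) (g x0) * n) with (2 * r * d (xi n) (g x0)) by (field; lra).
  assert (2 * r * D < e * n).
  { unfold n. replace (e * (r + D + 1 + 2 * r * D / e)) with (e * (r + D + 1) + 2 * r * D)
      by (field; lra).
    assert (0 < e * (r + D + 1)) by (apply Rmult_lt_0_compat; lra). lra. }
  nra.
Qed.

(** With the base point in the chamber, the segments to orbit points lie in the convex set [Y].
    Limit rays are their pointwise limits and stay in [Y], which is closed and covered by translates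
    of the compact closed chamber. *)
Lemma parabolic_convex_cocompact : convex_cocompact d (generated d T).
Proof.
  destruct chamber_nonempty as [c0 Cc]. exists (closure d C), c0.
  split; [exact chamber_closure_compact|].
  intros xi (Hr & H0 & Hc) t Ht.
  assert (Yt : Y (xi t)).
  { destruct (Req_dec t 0) as [->|Nt]; [rewrite H0; apply translates_chamber, Cc|].
    apply translates_closed. intros e e0.
    destruct (Hc t e ltac:(lra) e0) as (a & c & (g & Hg & <-) & Hlt & G & Hd).
    exists (c t); split; [|rewrite (dist_sym HX); exact Hd].
    apply (translates_convex c0 (g c0) c); [| |exact G|lra].
    - apply translates_chamber, Cc.
    - apply translates_image; [exact Hg|]. apply translates_chamber, Cc. }
  destruct Yt as (g & k & H); exists g, k; exact H.
Qed.

End Parabolic.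
End Basis.
End Chambers.

Theorem theorem2p4 (X : Type) (d : X -> X -> R) (HX : CAT0 d)
  (W : (X -> X) -> Prop) (C : X -> Prop) (HW : cocompact_discrete d W C)
  (S : (X -> X) -> Prop) (HS : minimal_basis d W C S)
  (T : (X -> X) -> Prop) (HT : forall t, T t -> S t) :
  convex d (translates d (generated d T) C) /\
  (forall (x0 : X) (xi : R -> X),
     limit_ray d (generated d T) x0 xi <->
     boundary_ray d (translates d (generated d T) C) x0 xi) /\
  convex_cocompact d (generated d T).
Proof.
  split; [exact (translates_convex HX HW HS HT)|split].
  - intros x0 xi; split.
    + exact (limit_ray_boundary HX HW HS HT x0 xi).
    + exact (boundary_ray_limit HX HW HS HT x0 xi).
  - exact (parabolic_convex_cocompact HX HW HS HT).
Qed.
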